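(* Let $R_\natural$ and $R_\sharp$ be the respective ultraproduct and cataproduct of Noetherian local rings $R_w$ of bounded embedding dimension. The following are equivalent: (1) $R_\natural$ is isodimensional; (2) almost all $R_w$ have dimension equal to $\operatorname{gdim}(R_\natural)$; (3) almost all $R_w$ have the same dimension as $R_\sharp$; (4) almost all $R_w$ have the same parameter degree (which is then also the parameter degree of $R_\natural$ and of $R_\sharp$).
   Context: Local rings are not assumed Noetherian; the embedding dimension is the minimal number of generators of the maximal ideal. Fix an infinite index set with a countably incomplete non-principal ultrafilter; ''almost all $w$'' means for all $w$ in a member of the ultrafilter. Bounded embedding dimension means that for some $m$ almost all $R_w$ have embedding dimension at most $m$. The ultraproduct $R_\natural$ is a local ring of finite embedding dimension, with maximal ideal $\mathfrak m_\natural$, and the cataproduct is $R_\sharp:=R_\natural/\bigcap_n\mathfrak m_\natural^n$ (a complete Noetherian local ring). For a local ring $(R,\mathfrak m)$ of finite embedding dimension: its geometric dimension $\operatorname{gdim}(R)$ is the least number of elements of $\mathfrak m$ generating an ideal $I$ with $R/I$ Artinian (for Noetherian rings this is the Krull dimension); a generic sequence is a tuple of length $\operatorname{gdim}(R)$ generating an $\mathfrak m$-primary ideal; the parameter degree of $R$ is the minimal length of $R/\mathbf xR$ where $\mathbf x$ runs over all generic sequences. An associated prime of an ideal $J$ is a prime of the form $(J:a)$; it is a minimal associated prime of $J$ if it properly contains no associated prime of $J$. The pi-dimension of $R$ is the least $d$ such that $\mathfrak m$ is a minimal associated prime of an ideal generated by $d$ elements. $R$ is isodimensional if its geometric dimension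 equals its pi-dimension. *)

(* Defs.v *)
From HB Require Import structures.
From mathcomp Require Import all_boot all_order all_algebra.
From mathcomp Require Import generic_quotient ring_quotient.
From mathcomp Require Import boolp classical_sets cardinality filter.

Set Implicit Arguments.
Unset Strict Implicit.
Unset Printing Implicit Defensive.

Import GRing.Theory.
Local Open Scope classical_set_scope.
Local Open Scope ring_scope.
Local Open Scope quotient_scope.

(* Invariants take values in [option nat], where [None] stands for infinity. *)

(* The minimum of a set of naturals, infinite for the empty set. *)
Definition min_nat (P : set nat) : option nat :=
  xget None (Some @` [set n | P n /\ forall k, P k -> (n <= k)%N]).

(* The supremum (least upper bound) of a set of naturals. *)
Definition sup_nat (P : set nat) : option nat :=
  min_nat [set d | forall n, P n -> (n <= d)%N].

Lemma min_natP (P : set nat) (n : nat) :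
  min_nat P = Some n <-> P n /\ forall k, P k -> (n <= k)%N.
Proof.
rewrite /min_nat; case: xgetP => [o _ [m [Pm lem] <-]|noP].
  split=> [[<-]//|[Pn len]].
  by congr Some; apply/eqP; rewrite eqn_leq lem//= len.
by split=> // Pn; case: (noP (Some n)); exists n.
Qed.

Lemma min_nat_None (P : set nat) : min_nat P = None <-> forall n, ~ P n.
Proof.
split=> [|noP].
  rewrite /min_nat; case: xgetP => [o _ [m _ <-]//|noP _ n Pn].
  have exP : exists n, `[< P n >] by exists n; apply/asboolP.
  case: (ex_minnP exP) => m /asboolP Pm lem.
  case: (noP (Some m)); exists m => //; split=> // k Pk.
  by apply: lem; apply/asboolP.
by case E: (min_nat P) => [n|//]; case/min_natP: E => /noP.
Qed.

(* J 0 < J 1 < ... < J n is a strict chain of n.+1 sets satisfying C. *)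
Definition strict_chain (T : Type) (C : set (set T)) (n : nat) : Prop :=
  exists J : nat -> set T,
    (forall i, (i <= n)%N -> C (J i)) /\
    (forall i, (i < n)%N -> J i `<` J i.+1).

Section Ideals.
Variable R : comPzRingType.
Implicit Types (A I J P Q M : set R) (s : seq R).

Definition ideal I : Prop :=
  [/\ I 0, forall x y, I x -> I y -> I (x + y) & forall a x, I x -> I (a * x)].

Definition ideal_gen A : set R := smallest ideal A.

Definition seq_ideal s : set R := ideal_gen [set` s].

Definition prime_ideal P : Prop :=
  [/\ ideal P, ~ P 1 & forall x y, P (x * y) -> P x \/ P y].

Definition maximal_ideal M : Prop :=
  [/\ ideal M, ~ M 1 & forall J, ideal J -> M `<=` J -> J = M \/ J = setT].

(* A maximal ideal being proper, the zero ring is not local. *)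
Definition local_ring : Prop := exists! M, maximal_ideal M.

(* The maximal ideal of R, meaningful when R is local. *)
Definition max_ideal : set R := xget set0 maximal_ideal.

Definition noetherian : Prop :=
  forall I, ideal I -> exists s, I = seq_ideal s.

Definition artinian : Prop :=
  forall J : nat -> set R, (forall n, ideal (J n)) ->
    (forall n, J n.+1 `<=` J n) ->
    exists N, forall n, (N <= n)%N -> J n = J N.

Definition ideal_exp I (n : nat) : set R :=
  ideal_gen [set x | exists2 t : 'I_n -> R,
                       (forall i, I (t i)) & x = \prod_i t i].

Definition radical I : set R := [set x | exists n, I (x ^+ n)].

Definition primary_ideal Q : Prop :=
  [/\ ideal Q, ~ Q 1 &
      forall x y, Q (x * y) -> Q x \/ exists n, Q (y ^+ n)].

Definition max_primary Q : Prop := primary_ideal Q /\ radical Q = max_ideal.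

Definition colon J (a : R) : set R := [set x | J (x * a)].

Definition associated_prime J P : Prop :=
  prime_ideal P /\ exists a, P = colon J a.

Definition minimal_associated_prime J P : Prop :=
  associated_prime J P /\ forall Q, associated_prime J Q -> ~ (Q `<` P).

Definition krull_dim : option nat := sup_nat (strict_chain prime_ideal).

(* Length of R as a module over itself. *)
Definition ring_length : option nat := sup_nat (strict_chain ideal).

Definition embdim : option nat :=
  min_nat [set d | exists2 s, size s = d & max_ideal = seq_ideal s].

Definition pidim : option nat :=
  min_nat [set d | exists2 s, size s = d &
                     minimal_associated_prime (seq_ideal s) max_ideal].

Lemma ideal_gen_ideal A : ideal (ideal_gen A).
Proof.
split=> [B [[B0 _ _] _]//|x y xA yA B BA|a x xA B BA].
  by have [[_ BD _] _] := BA; apply: BD; [exact: xA|exact: yA].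
by have [[_ _ BM] _] := BA; apply: BM; exact: xA.
Qed.

Lemma max_idealP : local_ring -> maximal_ideal max_ideal.
Proof. by case=> M [mM _]; exact: xgetI mM. Qed.

End Ideals.

Arguments local_ring R : clear implicits.
Arguments max_ideal R : clear implicits.
Arguments noetherian R : clear implicits.
Arguments artinian R : clear implicits.
Arguments krull_dim R : clear implicits.
Arguments ring_length R : clear implicits.
Arguments embdim R : clear implicits.
Arguments pidim R : clear implicits.

(* The quotient of R by the ideal generated by A.  [{ideal_quot I}] is
   restricted to proper ideals; here R / A may be the zero ring. *)
Section QuotientRing.
Variables (R : comPzRingType) (A : set R).

Definition gen_pred : {pred R} := fun x => `[< ideal_gen A x >].

Lemma gen_predP x : reflect (ideal_gen A x) (x \in gen_pred).
Proof. exact: asboolP. Qed.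

Fact gen_pred_zmod_closed : zmod_closed gen_pred.
Proof.
have [I0 ID IM] := ideal_gen_ideal A.
split=> [|x y /gen_predP xA /gen_predP yA]; first exact/gen_predP.
by apply/gen_predP; apply: ID => //; rewrite -mulN1r; apply: IM.
Qed.

HB.instance Definition _ := GRing.isZmodClosed.Build R gen_pred
  gen_pred_zmod_closed.

Definition quot_ring : Type := Quotient.quot gen_pred.

HB.instance Definition _ := GRing.Zmodule.on quot_ring.
HB.instance Definition _ :=
  EqQuotient.copy quot_ring (Quotient.quot gen_pred).

Definition quot_one : quot_ring := \pi_quot_ring 1.
Definition quot_mul (u v : quot_ring) : quot_ring :=
  \pi_quot_ring (repr u * repr v).

Lemma quot_piE (x y : R) :
  \pi_quot_ring x = \pi_quot_ring y <-> ideal_gen A (x - y).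
Proof.
have E := Quotient.idealrBE gen_pred x y.
split=> [/eqP|/gen_predP] xy; first by apply/gen_predP; rewrite E.
by apply/eqP; rewrite E in xy.
Qed.

Lemma quot_pi_add (x y : R) :
  \pi_quot_ring (x + y) = \pi_quot_ring x + \pi_quot_ring y.
Proof. by rewrite -[RHS](Quotient.pi_add gen_pred). Qed.

Lemma quot_pi_mul (x y : R) :
  \pi_quot_ring (x * y) = quot_mul (\pi_quot_ring x) (\pi_quot_ring y).
Proof.
have [I0 ID IM] := ideal_gen_ideal A.
have ex : ideal_gen A (x - repr (\pi_quot_ring x)).
  by apply/quot_piE; rewrite reprK.
have ey : ideal_gen A (y - repr (\pi_quot_ring y)).
  by apply/quot_piE; rewrite reprK.
apply/quot_piE; set x' := repr (_ x) in ex *; set y' := repr (_ y) in ey *.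
have -> : x * y - x' * y' = y * (x - x') + x' * (y - y').
  by rewrite !mulrBr [x' * y]mulrC addrA subrK mulrC.
by apply: ID; apply: IM.
Qed.

Fact quot_mulA : associative quot_mul.
Proof.
move=> u v w; rewrite -[u]reprK -[v]reprK -[w]reprK.
rewrite -(quot_pi_mul (repr v)) -!(quot_pi_mul (repr u)) -quot_pi_mul.
by rewrite mulrA.
Qed.

Fact quot_mulC : commutative quot_mul.
Proof. by move=> u v; rewrite /quot_mul mulrC. Qed.

Fact quot_mul1 : left_id quot_one quot_mul.
Proof. by move=> u; rewrite -[u]reprK -quot_pi_mul mul1r. Qed.

Fact quot_mulD : left_distributive quot_mul +%R.
Proof.
move=> u v w; rewrite -[u]reprK -[v]reprK -[w]reprK.
rewrite -quot_pi_add -(quot_pi_mul (repr u)) -(quot_pi_mul (repr v)).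
by rewrite -quot_pi_mul -quot_pi_add mulrDl.
Qed.

HB.instance Definition _ := GRing.Zmodule_isComPzRing.Build quot_ring
  quot_mulA quot_mulC quot_mul1 quot_mulD.

End QuotientRing.

Section GeometricDimension.
Variable R : comPzRingType.
Implicit Types s : seq R.

Definition gdim : option nat :=
  min_nat [set d | exists2 s, size s = d &
    [set` s] `<=` max_ideal R /\ artinian (quot_ring [set` s])].

Definition generic_seq s : Prop :=
  gdim = Some (size s) /\ max_primary (seq_ideal s).

(* The R-submodules of R / sR are the ideals of the ring R / sR, so its length
   as an R-module is its length as a ring. *)
Definition parameter_degree : option nat :=
  min_nat [set l | exists2 s, generic_seq s &
    ring_length (quot_ring [set` s]) = Some l].

Definition isodimensional : Prop := gdim = pidim R.

End GeometricDimension.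

Arguments gdim R : clear implicits.
Arguments parameter_degree R : clear implicits.
Arguments isodimensional R : clear implicits.

Section ProductRing.
Variables (W : Type) (R : W -> comPzRingType).

Definition prod_ring : Type := forall w, R w.

HB.instance Definition _ := Choice.on prod_ring.

Implicit Types f g : prod_ring.

Fact prod_addA : associative (fun f g w => f w + g w : R w).
Proof. by move=> f g h; apply: functional_extensionality_dep => w; exact: addrA. Qed.
Fact prod_addC : commutative (fun f g w => f w + g w : R w).
Proof. by move=> f g; apply: functional_extensionality_dep => w; exact: addrC. Qed.
Fact prod_add0 : left_id (fun w => 0 : R w) (fun f g w => f w + g w : R w).
Proof. by move=> f; apply: functional_extensionality_dep => w; exact: add0r. Qed.
Fact prod_addN : left_inverse (fun w => 0 : R w) (fun f w => - f w : R w)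
  (fun f g w => f w + g w : R w).
Proof. by move=> f; apply: functional_extensionality_dep => w; exact: addNr. Qed.

HB.instance Definition _ := GRing.isZmodule.Build prod_ring
  prod_addA prod_addC prod_add0 prod_addN.

Fact prod_mulA : associative (fun f g w => f w * g w : R w).
Proof. by move=> f g h; apply: functional_extensionality_dep => w; exact: mulrA. Qed.
Fact prod_mulC : commutative (fun f g w => f w * g w : R w).
Proof. by move=> f g; apply: functional_extensionality_dep => w; exact: mulrC. Qed.
Fact prod_mul1 : left_id (fun w => 1 : R w) (fun f g w => f w * g w : R w).
Proof. by move=> f; apply: functional_extensionality_dep => w; exact: mul1r. Qed.
Fact prod_mulD :
  @left_distributive prod_ring _ (fun f g w => f w * g w : R w) +%R.
Proof. by move=> f g h; apply: functional_extensionality_dep => w; exact: mulrDl. Qed.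

HB.instance Definition _ := GRing.Zmodule_isComPzRing.Build prod_ring
  prod_mulA prod_mulC prod_mul1 prod_mulD.

End ProductRing.

Section Ultraproduct.
Variables (W : Type) (U : set_system W) (R : W -> comPzRingType).

Definition almost_zero : set (prod_ring R) :=
  [set f | \forall w \near U, f w = 0].

Lemma almost_zero_ideal : Filter U -> ideal almost_zero.
Proof.
move=> UF; split=> [|f g|a f].
- exact: filterE.
- by apply: filterS2 => w /= fw gw; rewrite [LHS](congr2 +%R fw gw) addr0.
- by apply: filterS => w /= fw; rewrite [LHS](congr1 ( *%R (a w)) fw) mulr0.
Qed.

Definition ultraproduct : comPzRingType := quot_ring almost_zero.

Lemma ultraproduct_eqP (f g : prod_ring R) : Filter U ->
  \pi_(quot_ring almost_zero) f = \pi_(quot_ring almost_zero) g <->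
  \forall w \near U, f w = g w.
Proof.
move=> UF; rewrite quot_piE /ideal_gen smallest_id; last exact: almost_zero_ideal.
split; apply: filterS => w /=.
  by move/subr0_eq.
by move=> /eqP; rewrite -subr_eq0 => /eqP.
Qed.

Definition cataproduct : comPzRingType :=
  quot_ring (\bigcap_n ideal_exp (max_ideal ultraproduct) n).

End Ultraproduct.

Definition nonprincipal (W : Type) (U : set_system W) : Prop :=
  forall w, U <> principal_filter w.

Definition countably_incomplete (W : Type) (U : set_system W) : Prop :=
  exists A : nat -> set W, (forall n, U (A n)) /\ ~ U (\bigcap_n A n).

Definition bounded_embdim (W : Type) (U : set_system W)
    (R : W -> comPzRingType) : Prop :=
  exists m : nat, \forall w \near U,
    exists2 e, embdim (R w) = Some e & (e <= m)%N.

(* Main.v *)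
Require Import Defs.
From mathcomp Require Import all_boot all_order all_algebra.
From mathcomp Require Import generic_quotient.
From mathcomp Require Import boolp classical_sets cardinality filter.
From mathcomp Require Import ring zify.

(** The condition that decides everything is whether the dimension d' common to
    almost all R_w equals d = gdim(R_nat).  Membership in a finitely generated ideal
    transfers between R_nat and almost all R_w, hence so do the length of
    R/(s), which is the largest size of a sequence t with t_i not in
    (s, t_0, ..., t_{i-1}), and the fact that the maximal ideal is a prime
    colon ideal ((s) : a).  From this d' <= d, pidim(R_nat) = d', and
    sequences s_w with R_w/(s_w) of bounded length glue to a sequence s with
    m^l contained in (s), so that d = d' as soon as the parameter degrees
    agree.  Countable incompleteness makes finitely generated ideals of the
    cataproduct closed, which makes it Noetherian, of Krull dimension d. *)

Set Implicit Arguments.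
Unset Strict Implicit.
Unset Printing Implicit Defensive.

Import GRing.Theory.
Local Open Scope classical_set_scope.
Local Open Scope ring_scope.

(** * Ideals *)

Section Ideals.
Variable R : comPzRingType.
Implicit Types (I J K P Q M : set R) (s t : seq R) (a b x y z : R).

(** The obstacle is uniformity. A system of parameters of R_w generates an ideal containing some
    power of the maximal ideal, but the exponent may grow with w, so such systems need not glue to
    one of R_nat; in the other direction, one exponent for R_nat serves almost all w. Hence only d'
    <= d is automatic, and a common length l restores uniformity because length l forces exponent l.
    The condition ((s) : a) = m mentions no exponent, so it glues, which pins the pi-dimension to d'
    whatever d is. R_nat need not be Noetherian: about it only finite generation of the maximal
    ideal, Nakayama's lemma and finite length are used, while Krull and geometric dimension are
    compared only in the R_w and in the cataproduct. Localizations and residue domains are never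
    formed: R_P is replaced by ideals saturated with respect to P, and R/N by chains of primes
    starting at N, so Krull's height theorem is proved relative to a base prime. *)

Lemma ideal0 I : ideal I -> I 0. Proof. by case. Qed.
Lemma idealD I x y : ideal I -> I x -> I y -> I (x + y).
Proof. by case=> _ D _; exact: D. Qed.
Lemma idealMl I a x : ideal I -> I x -> I (a * x).
Proof. by case=> _ _ M; exact: M. Qed.
Lemma idealMr I a x : ideal I -> I x -> I (x * a).
Proof. by rewrite mulrC; exact: idealMl. Qed.
Lemma idealN I x : ideal I -> I x -> I (- x).
Proof. by move=> iI Ix; rewrite -mulN1r; exact: idealMl. Qed.
Lemma idealB I x y : ideal I -> I x -> I y -> I (x - y).
Proof. by move=> iI Ix Iy; apply: idealD => //; exact: idealN. Qed.

Lemma ideal_setT : ideal [set: R]. Proof. by []. Qed.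

Lemma ideal_set0 : ideal [set (0 : R)].
Proof.
by split=> //= [x y -> ->|a x ->]; rewrite ?addr0 ?mulr0.
Qed.

Lemma ideal1 I : ideal I -> I 1 -> I = setT.
Proof.
by move=> iI I1; rewrite -subTset => x _; rewrite -[x]mulr1; exact: idealMl.
Qed.

Lemma prime_is_ideal P : prime_ideal P -> ideal P. Proof. by case. Qed.

Lemma primeN1 P : prime_ideal P -> ~ P 1. Proof. by case. Qed.

Lemma primeM P x y : prime_ideal P -> P (x * y) -> P x \/ P y.
Proof. by case=> _ _; exact. Qed.

Lemma prime_complM P x y : prime_ideal P -> ~ P x -> ~ P y -> ~ P (x * y).
Proof. by move=> pP nx ny /(primeM pP)[]. Qed.

Lemma primeX P x n : prime_ideal P -> P (x ^+ n) -> P x.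
Proof.
move=> pP; elim: n => [/(primeN1 pP)//|n IH].
by rewrite exprS => /(primeM pP)[].
Qed.

(** Two uses share this form: [P := setT] gives I + (x), from which generated ideals are built, and
    a prime [P] gives the I + Px of Nakayama's lemma. *)
Definition adj P I x : set R :=
  [set y | exists a r, [/\ I a, P r & y = a + r * x]].

Definition adjs P I s : set R := foldr (fun x J => adj P J x) I s.

Lemma ideal_adj P I x : ideal P -> ideal I -> ideal (adj P I x).
Proof.
move=> iP iI; split.
- by exists 0, 0; split; [exact: ideal0..|rewrite mul0r addr0].
- move=> _ _ [a [r [Ia Pr ->]]] [b [q [Ib Pq ->]]].
  by exists (a + b), (r + q); split; [exact: idealD..|ring].
- move=> c _ [a [r [Ia Pr ->]]].
  by exists (c * a), (c * r); split; [exact: idealMl..|ring].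
Qed.

Lemma ideal_adjs P I s : ideal P -> ideal I -> ideal (adjs P I s).
Proof. by move=> iP iI; elim: s => //= x s; exact: ideal_adj. Qed.

Lemma sub_adj P I x : ideal P -> I `<=` adj P I x.
Proof.
by move=> iP y Iy; exists y, 0; rewrite mul0r addr0; split=> //; exact: ideal0.
Qed.

Lemma sub_adjs P I s : ideal P -> I `<=` adjs P I s.
Proof. by move=> iP; elim: s => //= x s IH y /IH; exact: sub_adj. Qed.

Lemma mem_adj I x : ideal I -> adj setT I x x.
Proof. by move=> iI; exists 0, 1; split; [exact: ideal0| |ring]. Qed.

Lemma mem_adjs I s x : ideal I -> x \in s -> adjs setT I s x.
Proof.
move=> iI; elim: s => //= y s IH; rewrite inE => /orP[/eqP->|/IH xs].
  by apply: mem_adj; exact: ideal_adjs.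
exact: sub_adj.
Qed.

Lemma mem_adjsM P I s p x : ideal P -> ideal I -> P p -> x \in s ->
  adjs P I s (p * x).
Proof.
move=> iP iI Pp; elim: s => //= y s IH; rewrite inE => /orP[/eqP->|/IH].
  exists 0, p; split=> //; last by rewrite add0r.
  by apply: ideal0; exact: ideal_adjs.
exact: sub_adj.
Qed.

Lemma adj_sub P I J x : ideal J -> I `<=` J -> J x -> adj P I x `<=` J.
Proof.
by move=> iJ IJ Jx _ [a [r [/IJ Ia _ ->]]]; apply: idealD => //; exact: idealMl.
Qed.

Lemma adjs_sub P I J s : ideal J -> I `<=` J -> (forall x, x \in s -> J x) ->
  adjs P I s `<=` J.
Proof.
move=> iJ IJ; elim: s => //= x s IH sJ; apply: adj_sub => //.
  by apply: IH => y ys; apply: sJ; rewrite inE ys orbT.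
by apply: sJ; rewrite inE eqxx.
Qed.

Lemma seq_idealE s : seq_ideal s = adjs setT [set 0] s.
Proof.
apply/seteqP; split.
  apply: smallest_sub; first by apply: ideal_adjs => //; exact: ideal_set0.
  by move=> x; exact: mem_adjs ideal_set0.
apply: adjs_sub; first exact: ideal_gen_ideal.
  by move=> _ ->; exact: ideal0 (ideal_gen_ideal _).
by move=> x xs J [_]; exact.
Qed.

Lemma ideal_seq s : ideal (seq_ideal s).
Proof. exact: ideal_gen_ideal. Qed.

Lemma mem_seq_ideal s x : x \in s -> seq_ideal s x.
Proof. by move=> xs J [_]; exact. Qed.

Lemma seq_ideal_sub s J : ideal J -> (forall x, x \in s -> J x) ->
  seq_ideal s `<=` J.
Proof. by move=> iJ sJ; apply: smallest_sub. Qed.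

Lemma seq_ideal_nil : seq_ideal [::] = [set (0 : R)].
Proof. by rewrite seq_idealE. Qed.

Lemma seq_ideal_cons x s : seq_ideal (x :: s) = adj setT (seq_ideal s) x.
Proof. by rewrite !seq_idealE. Qed.

Lemma seq_ideal_catP s t x :
  seq_ideal (s ++ t) x <-> exists y z, [/\ seq_ideal s y, seq_ideal t z & x = y + z].
Proof.
split; last first.
  move=> [y [z [sy tz ->]]]; apply: (idealD (ideal_seq _)).
    apply: (seq_ideal_sub _ _ sy); first exact: ideal_seq.
    by move=> u us; apply: mem_seq_ideal; rewrite mem_cat us.
  apply: (seq_ideal_sub _ _ tz); first exact: ideal_seq.
  by move=> u us; apply: mem_seq_ideal; rewrite mem_cat us orbT.
elim: s x => [|a s IH] x /=.
  by move=> tx; exists 0, x; split; [exact: ideal0 (ideal_seq _)| |rewrite add0r].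
rewrite seq_ideal_cons => -[c [r [/IH[y [z [sy tz ->]]] _ ->]]].
exists (y + r * a), z; split=> //; last ring.
by rewrite seq_ideal_cons; exists y, r.
Qed.

(* For a prime P this is the contraction of I R_P to R. *)
Definition sat P I : set R := [set a | exists2 u, ~ P u & I (u * a)].

Lemma ideal_sat P I : prime_ideal P -> ideal I -> ideal (sat P I).
Proof.
move=> pP iI; split.
- by exists 1; [exact: (primeN1 pP)|rewrite mulr0; exact: ideal0].
- move=> x y [u nu Iu] [v nv Iv]; exists (u * v); first exact: prime_complM.
  have -> : u * v * (x + y) = v * (u * x) + u * (v * y) by ring.
  by apply: idealD => //; exact: idealMl.
- move=> a x [u nu Iu]; exists u => //.
  by rewrite mulrCA; exact: idealMl.
Qed.

Lemma sub_sat P I : prime_ideal P -> I `<=` sat P I.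
Proof. by move=> pP x Ix; exists 1; [exact: (primeN1 pP)|rewrite mul1r]. Qed.

Lemma sat_sat P I : prime_ideal P -> sat P (sat P I) `<=` sat P I.
Proof.
move=> pP x [u nu [v nv Iv]]; exists (v * u); first exact: prime_complM.
by rewrite -mulrA.
Qed.

Lemma sat_mono P I J : I `<=` J -> sat P I `<=` sat P J.
Proof. by move=> IJ x [u nu /IJ Ju]; exists u. Qed.

(** Nakayama's lemma over R_P with denominators cleared. The head x satisfies ux = k + px with u
    outside P and p in P, so u - p is again outside P, a unit of R_P, and x is eliminated in favour
    of the tail. *)
Lemma nakayama P K s : prime_ideal P -> ideal K ->
  (forall x, x \in s -> sat P (adjs P K s) x) ->
  forall x, x \in s -> sat P K x.
Proof.
move=> pP iK; have iP := prime_is_ideal pP.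
elim: s => // x s IH H.
have [w nw wx] : exists2 w, ~ P w & adjs P K s (w * x).
  have [u nu [k [p [Kk Pp E]]]] := H x (mem_head _ _).
  exists (u - p).
    by move=> Pup; apply: nu; rewrite -[u](subrK p); exact: idealD.
  by rewrite mulrBl E addrK.
have IHs : forall y, y \in s -> sat P K y.
  apply: IH => y ys; have [|u nu [k [p [Kk Pp E]]]] := H y.
    by rewrite inE ys orbT.
  exists (w * u); first exact: prime_complM.
  rewrite -mulrA E mulrDr mulrCA.
  have iA := ideal_adjs s iP iK.
  by apply: idealD => //; exact: idealMl.
have {}wx : sat P K (w * x).
  apply: adjs_sub wx => //; first exact: ideal_sat.
  exact: sub_sat.
move=> y; rewrite inE => /orP[/eqP->|/IHs//].
case: wx => v nv Kv; exists (v * w); first exact: prime_complM.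
by rewrite -mulrA.
Qed.

(** The form of locality that transfers to ultraproducts: inverses outside M are given, not deduced
    from the uniqueness of a maximal ideal. *)
Definition local_at M := [/\ ideal M, ~ M 1 & forall x, ~ M x -> exists y, y * x = 1].

Lemma local_at_ideal M : local_at M -> ideal M. Proof. by case. Qed.

Lemma proper_sub_local_at M I : local_at M -> ideal I -> ~ I 1 -> I `<=` M.
Proof.
move=> [iM _ uM] iI nI1 x Ix; apply: contrapT => /uM[y yx].
by apply: nI1; rewrite -yx; exact: idealMl.
Qed.

Lemma local_at_maximal M : local_at M -> maximal_ideal M.
Proof.
move=> lM; have [iM M1 uM] := lM; split=> // J iJ MJ.
have [J1|nJ1] := pselect (J 1); first by right; exact: ideal1.
by left; apply/seteqP; split=> //; exact: proper_sub_local_at.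
Qed.

Lemma local_at_uniq M N : local_at M -> maximal_ideal N -> M = N.
Proof.
move=> lM [iN N1 mN]; have [iM M1 _] := lM.
have [//|T] := mN M iM (proper_sub_local_at lM iN N1).
by case: M1; rewrite T.
Qed.

Lemma local_at_local M : local_at M -> local_ring R.
Proof.
move=> lM; exists M; split; first exact: local_at_maximal.
by move=> N; exact: local_at_uniq.
Qed.

Lemma local_at_max M : local_at M -> max_ideal R = M.
Proof.
move=> lM; have /max_idealP mM := local_at_local lM.
by rewrite (local_at_uniq lM mM).
Qed.

Lemma local_at_prime M : local_at M -> prime_ideal M.
Proof.
move=> [iM M1 uM]; split=> // x y Mxy.
have [|/uM[z zx]] := pselect (M x); [by left|right].
have -> : y = z * (x * y) by rewrite mulrA zx mul1r.
exact: idealMl.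
Qed.

(** Localizing at the maximal ideal changes nothing, so the lemmas on [sat] and [len_le] also speak
    of the local ring itself. *)
Lemma local_at_sat M I : local_at M -> ideal I -> sat M I = I.
Proof.
move=> lM iI; apply/seteqP; split; last exact: sub_sat (local_at_prime lM).
move=> x [u nu Iu]; have [_ _ /(_ u nu) [v vu]] := lM.
by rewrite -[x]mul1r -vu -mulrA; exact: idealMl.
Qed.

(** No sums are taken: containment in an ideal means the same as for the product ideal, and
    membership has a fixed number of witnesses, so it transfers to ultraproducts. *)
Fixpoint prods (L : seq (set R)) : set R :=
  if L is Q :: L' then
    [set z | exists x y, [/\ Q x, prods L' y & z = x * y]]
  else [set 1].

Notation pw M k := (prods (nseq k M)).

Lemma prods_cat L1 L2 z : prods (L1 ++ L2) z ->
  exists x y, [/\ prods L1 x, prods L2 y & z = x * y].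
Proof.
elim: L1 z => [|Q L1 IH] z /=; first by exists 1, z; rewrite mul1r.
move=> [x [_ [Qx /IH[y [y' [L1y L2y ->]]] ->]]].
by exists (x * y), y'; split; [exists x, y| |rewrite mulrA].
Qed.

Fixpoint mons k s : seq R :=
  if k is k'.+1 then flatten [seq [seq x * y | y <- mons k' s] | x <- s] else [:: 1].

Lemma mons_pw M k s z : (forall x, x \in s -> M x) -> z \in mons k s -> pw M k z.
Proof.
move=> sM; elim: k z => [|k IH] z /=; first by rewrite inE => /eqP.
move=> /flatten_mapP[x xs /mapP[y yk ->]].
by exists x, y; split=> //; [exact: sM|exact: IH].
Qed.

Lemma pw_mons k s : pw (seq_ideal s) k `<=` seq_ideal (mons k s).
Proof.
elim: k => [|k IH] /= z; first by move=> ->; apply: mem_seq_ideal; rewrite inE.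
move=> [x [y [sx /IH ky ->]]]; set J := seq_ideal _.
have iJ : ideal J by exact: ideal_seq.
have iC a : ideal [set b | J (a * b)].
  split=> /= [|b c ab ac|c b ab].
  - by rewrite mulr0; exact: (ideal0 iJ).
  - by rewrite mulrDr; exact: (idealD iJ).
  - by rewrite mulrCA; exact: (@idealMl _ _ _ iJ).
rewrite mulrC; apply: (@seq_ideal_sub s _ (iC y) _ x sx) => a sa /=.
rewrite mulrC; apply: (@seq_ideal_sub _ _ (iC a) _ y ky) => b kb /=.
apply: mem_seq_ideal; apply/flatten_mapP.
by exists a => //; apply/mapP; exists b.
Qed.

Lemma pw_prod M k z : pw M k z <->
  exists2 t : 'I_k -> R, (forall i, M (t i)) & z = \prod_i t i.
Proof.
elim: k z => [|k IH] z /=.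
  split=> [->|[t _ ->]]; last by rewrite big_ord0.
  by exists (fun=> 1); [case|rewrite big_ord0].
split.
  move=> [x [_ [Mx /IH[t Mt ->] ->]]].
  exists (fun i => if unlift ord0 i is Some j then t j else x).
    by move=> i; case: unlift.
  rewrite big_ord_recl unlift_none; congr (_ * _); apply: eq_bigr => i _.
  by rewrite liftK.
move=> [t Mt ->]; rewrite big_ord_recl.
exists (t ord0), (\prod_(i < k) t (lift ord0 i)); split=> //.
by apply/IH; exists (fun i => t (lift ord0 i)).
Qed.

Lemma ideal_exp_pw M k : ideal_exp M k = ideal_gen (pw M k).
Proof.
rewrite /ideal_exp; congr ideal_gen; apply/seteqP.
by split=> z /pw_prod.
Qed.

Lemma ideal_exp_mons k s : ideal_exp (seq_ideal s) k = seq_ideal (mons k s).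
Proof.
rewrite ideal_exp_pw; apply/seteqP; split.
  by apply: smallest_sub; [exact: ideal_seq|exact: pw_mons].
apply: seq_ideal_sub; first exact: ideal_gen_ideal.
move=> z zk J [_]; apply; apply: mons_pw zk => x.
exact: mem_seq_ideal.
Qed.

Lemma pw_exp M k x : M x -> pw M k (x ^+ k).
Proof.
by move=> Mx; elim: k => //= k IH; exists x, (x ^+ k); rewrite exprS.
Qed.

Definition sat_ideal P J := ideal J /\ sat P J `<=` J.

(* The length of R_P / I R_P is at most N: ideals of R_P are represented by
   their contractions. *)
Definition len_le P I N := forall J : nat -> set R,
  (forall i, sat_ideal P (J i)) -> (forall i, I `<=` J i) ->
  (forall i, J i `<=` J i.+1) ->
  forall n, (\sum_(i < n) (`[< J i <> J i.+1 >] : nat) <= N)%N.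

Lemma sum_first_true (b : nat -> bool) n : (forall i, b i -> b i.+1) ->
  (\sum_(i < n) ((~~ b i && b i.+1) : nat) <= 1)%N.
Proof.
move=> mb; suff : (\sum_(i < n) ((~~ b i && b i.+1) : nat) <= b n)%N.
  by case: (b n) => // /leq_trans; apply.
elim: n => [|n IH]; first by rewrite big_ord0.
rewrite big_ord_recr /=; have := mb n; move: IH; case: (b n) => /=.
  by move=> IH ->//; rewrite addn0.
by rewrite leqn0 => /eqP-> _.
Qed.

(** Over R_P the quotient (I + (x))/I is zero or simple, so it costs at most one step: a strict step
    of the chain either stays strict after adjoining x or is the one at which x enters the chain. *)
Lemma len_le_adj P I x N : prime_ideal P -> ideal I -> (forall p, P p -> I (p * x)) ->
  len_le P (adj setT I x) N -> len_le P I N.+1.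
Proof.
move=> pP iI xP lN J sJ IJ mJ n.
pose J' i := sat P (adj setT (J i) x).
have iJ i : ideal (J i) by case: (sJ i).
have iA i : ideal (adj setT (J i) x) by exact: ideal_adj.
have mA i : adj setT (J i) x `<=` adj setT (J i.+1) x.
  apply: adj_sub => //; last exact: mem_adj.
  by apply: subset_trans (mJ i) _; exact: sub_adj.
have lJ' := lN J' _ _ _ n.
have {lJ'}/lJ' H : forall i, sat_ideal P (J' i).
  by move=> i; split; [exact: ideal_sat|exact: sat_sat].
rewrite -addn1.
apply: leq_trans (leq_add (H _ _)
  (sum_first_true (b := fun i => `[< J i x >]) n _)).
- rewrite -big_split /=; apply: leq_sum => i _.
  case: asboolP => // ne; case: asboolP => //= /contrapT E.
  rewrite add0n lt0b; move: ne; rewrite eqEsubset => /not_andP[]; first by move=> /(_ (mJ i)).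
  move=> /existsNP[z] /not_implyP[Jz nJz].
  have : J' i.+1 z by apply: sub_sat => //; exact: sub_adj.
  (* Here uz = a + rx with a in [J i]. Were x in [J i], or r in P (so that rx is in I), z would lie
     in [J i]. So r is outside P, and rx = uz - a puts x in [J i.+1]. *)
  rewrite -E => -[u nu [a [r [Ja _ uz]]]].
  have nx : ~ J i x.
    move=> Jx; apply: nJz; case: (sJ i) => _; apply; exists u => //.
    by rewrite uz; apply: idealD => //; exact: idealMl.
  apply/andP; split; first exact/asboolPn.
  apply/asboolP; case: (sJ i.+1) => _; apply.
  exists r; last first.
    have -> : r * x = u * z - a by rewrite uz addrC addKr.
    by apply: idealB; rewrite //; [exact: idealMl|exact: mJ].
  move=> Pr; apply: nJz; case: (sJ i) => _; apply; exists u => //.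
  by rewrite uz; apply: idealD => //; apply: IJ; exact: xP.
- move=> i; apply: subset_trans (sub_sat pP).
  apply: adj_sub => //; last exact: mem_adj.
  by apply: subset_trans (IJ i) _; exact: sub_adj.
- by move=> i; exact: sat_mono.
- by move=> i /asboolP Ji; apply/asboolP; exact: mJ.
Qed.

Lemma len_le_adjs P I s N : prime_ideal P -> ideal I ->
  (forall x p, x \in s -> P p -> I (p * x)) ->
  len_le P (adjs setT I s) N -> exists N', len_le P I N'.
Proof.
move=> pP iI; elim: s N => [|x s IH] N xP lN; first by exists N.
apply: (IH N.+1) => [y p ys|]; first by apply: xP; rewrite inE ys orbT.
apply: len_le_adj lN => //; first exact: ideal_adjs.
by move=> p Pp; apply: sub_adjs => //; apply: xP => //; rewrite inE eqxx.
Qed.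

(** Induction on k: modulo I, the elements uy with y a monomial of degree k - 1 in the generators of
    P are killed by P, so adjoining them costs finitely many steps and lowers the exponent. *)
Lemma finite_length P I u k g : prime_ideal P -> P = seq_ideal g -> ideal I ->
  ~ P u -> (forall y, pw P k y -> I (u * y)) -> exists N, len_le P I N.
Proof.
move=> pP Pg; elim: k I => [|k IH] I iI nu uP.
  exists 0%N => J sJ IJ mJ n; rewrite big1// => i _.
  have JT j : J j = setT.
    case: (sJ j) => iJ sJj; apply: ideal1 => //; apply: sJj.
    by exists u => //; apply: IJ; exact: uP.
  by case: asboolP => // ne; case: ne; rewrite !JT.
pose s := [seq u * y | y <- mons k g].
have [N lN] : exists N, len_le P (adjs setT I s) N.
  apply: IH => //; first exact: ideal_adjs.
  rewrite Pg => y /pw_mons ky.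
  suff /(_ y ky) : seq_ideal (mons k g) `<=` [set y | adjs setT I s (u * y)] by [].
  have iA : ideal (adjs setT I s) by exact: ideal_adjs.
  apply: seq_ideal_sub.
    split=> /= [|b c ab ac|c b ab].
    - by rewrite mulr0; exact: ideal0.
    - by rewrite mulrDr; exact: idealD.
    - by rewrite mulrCA; exact: idealMl.
  by move=> z zk /=; apply: mem_adjs => //; apply/mapP; exists z.
apply: len_le_adjs lN => // _ p /mapP[y yk ->] Pp.
rewrite mulrCA; apply: uP; exists p, y; split=> //.
by apply: mons_pw yk; rewrite Pg; exact: mem_seq_ideal.
Qed.

Lemma len_le_chain P I N (J : nat -> set R) n : len_le P I N ->
  (forall i, (i <= n)%N -> sat_ideal P (J i)) ->
  (forall i, (i <= n)%N -> I `<=` J i) ->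
  (forall i, (i < n)%N -> J i `<` J i.+1) -> (n <= N)%N.
Proof.
move=> lN sJ IJ mJ.
have := lN (fun i => J (minn i n)) _ _ _ n.
rewrite (eq_bigr (fun=> 1%N)) ?sum1_card ?card_ord; last first.
  move=> i _; rewrite !(minn_idPl _)// 1?ltnW//.
  by case: asboolP => // /contrapT E; have := mJ i (ltn_ord i); rewrite -E => -[? []].
apply=> i; [exact/sJ/geq_minr|exact/IJ/geq_minr|].
have [lt|ge] := ltnP i n; last by rewrite !(minn_idPr _)// ltnW.
by rewrite !(minn_idPl _)// 1?ltnW//; case: (mJ i lt).
Qed.

(* A decreasing sequence of n steps is an increasing one read backwards. *)
Lemma len_le_desc P I N (J : nat -> set R) : len_le P I N ->
  (forall i, sat_ideal P (J i)) -> (forall i, I `<=` J i) ->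
  (forall i, J i.+1 `<=` J i) ->
  exists n, forall k, (n <= k)%N -> J k = J n.
Proof.
move=> lN sJ IJ mJ.
pose S n := (\sum_(i < n) (`[< J i <> J i.+1 >] : nat))%N.
have SN n : (S n <= N)%N.
  have := lN (fun i => J (n - i)%N) _ _ _ n; rewrite /S.
  rewrite [X in _ -> _ -> _ -> (X <= _)%N](_ : _ = S n); last first.
    rewrite /S (reindex_inj rev_ord_inj) /=; apply: eq_bigr => i _.
    have -> : (n - (n - i.+1) = i.+1)%N by have := ltn_ord i; lia.
    have -> : (n - (n - i.+1).+1 = i)%N by have := ltn_ord i; lia.
    by congr nat_of_bool; apply: asbool_equiv_eq; split=> ne E; apply: ne.
  apply=> i //; have [lt|ge] := ltnP i n.
    by have -> : (n - i = (n - i.+1).+1)%N by lia.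
  by have -> : (n - i = n - i.+1)%N by lia.
have Smono n : (S n <= S n.+1)%N by rewrite /S big_ord_recr leq_addr.
have [n maxn] : exists n, forall k, (S k <= S n)%N.
  have exS : exists m, `[< exists n, S n = m >] by exists (S 0%N); apply/asboolP; exists 0%N.
  have bS m : `[< exists n, S n = m >] -> (m <= N)%N.
    by move/asboolP => [n <-].
  have [m /asboolP[n Sn] le] := ex_maxnP exS bS.
  by exists n => k; rewrite Sn; apply: le; apply/asboolP; exists k.
exists n; elim=> [|k IH]; first by rewrite leqn0 => /eqP->.
rewrite leq_eqVlt => /orP[/eqP->//|]; rewrite ltnS => nk; rewrite -(IH nk).
have SE : S k = S n.
  apply/eqP; rewrite eqn_leq maxn /=; elim: k nk {IH} => [|k IH].
    by rewrite leqn0 => /eqP->.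
  rewrite leq_eqVlt => /orP[/eqP->//|]; rewrite ltnS => /IH/leq_trans; exact.
have := maxn k.+1; rewrite -SE /S big_ord_recr /= -[X in (_ <= X)%N]addn0 leq_add2l.
by case: asboolP => // /contrapT->.
Qed.

End Ideals.

Notation pw M k := (prods (nseq k M)).

(** * Noetherian rings *)

Section Noetherian.
Variable R : comPzRingType.
Implicit Types (I J K P Q M N : set R) (s t : seq R) (a b x y z : R).

Hypothesis noethR : noetherian R.

Lemma noetherian_max (F : set (set R)) I0 : F `<=` @ideal R -> F I0 ->
  exists2 I, F I & forall J, F J -> I `<=` J -> J = I.
Proof.
move=> Fi F0; apply: contrapT => nex.
have step (I : {I | F I}) : exists J : {I | F I}, sval I `<` sval J.
  case: I => I FI /=; apply: contrapT => nJ; apply: nex; exists I => // J FJ IJ.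
  apply: contrapT => JI; apply: nJ; exists (exist _ J FJ) => /=.
  by split=> // JsI; apply: JI; apply/seteqP.
have [f fP] := choice step.
pose J n := sval (iter n f (exist _ I0 F0)).
have iJ n : ideal (J n) by apply: Fi; exact: svalP.
have mJ m n : (m <= n)%N -> J m `<=` J n.
  elim: n => [|n IH]; first by rewrite leqn0 => /eqP->.
  rewrite leq_eqVlt => /orP[/eqP->//|/IH H]; apply: subset_trans H _.
  by rewrite /J /=; have [? _] := fP (iter n f (exist _ I0 F0)).
have iU : ideal (\bigcup_n J n).
  split=> [|x y [m _ Jx] [n _ Jy]|a x [n _ Jx]].
  - by exists 0%N => //; exact: ideal0.
  - exists (maxn m n) => //; apply: idealD => //.
      exact: mJ (leq_maxl _ _) _ Jx.
    exact: mJ (leq_maxr _ _) _ Jy.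
  - by exists n => //; exact: idealMl.
have [s Us] := noethR iU.
have [n sn] : exists n, forall x, x \in s -> J n x.
  have : forall x, x \in s -> (\bigcup_n J n) x.
    by move=> x; rewrite Us; exact: mem_seq_ideal.
  elim: s {Us} => [|x s IH] H; first by exists 0%N.
  have [y ys|n nP] := IH; first by apply: H; rewrite inE ys orbT.
  have [m _ mP] := H x (mem_head _ _).
  exists (maxn m n) => y; rewrite inE => /orP[/eqP->|/nP].
    exact: mJ (leq_maxl _ _) _ mP.
  by apply: mJ; exact: leq_maxr.
have [_ []] := fP (iter n f (exist _ I0 F0)).
suff : J n.+1 `<=` J n by [].
apply: (@subset_trans _ (\bigcup_n J n)); first exact: bigcup_sup.
by rewrite Us; apply: seq_ideal_sub.
Qed.

(** An ideal maximal among the proper ideals containing a nonunit x is a maximal ideal, hence the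
    only one. *)
Lemma noetherian_local_at : local_ring R -> local_at (max_ideal R).
Proof.
move=> lR; have [iM M1 mM] := max_idealP lR; split=> // x nMx.
apply: contrapT => nux.
pose F := [set I | [/\ ideal I, ~ I 1 & I x]].
have F0 : F (adj setT [set 0] x).
  split.
  - by apply: ideal_adj => //; exact: ideal_set0.
  - move=> [a [r [-> _ E]]]; apply: nux; exists r.
    by rewrite add0r in E.
  - by apply: mem_adj; exact: ideal_set0.
have [|I [iI I1 Ix] maxI] := noetherian_max _ F0; first by move=> I [].
have mI : maximal_ideal I.
  split=> // J iJ IJ; have [J1|J1] := pselect (J 1).
    by right; exact: ideal1.
  by left; apply: maxI => //; split=> //; exact: IJ.
have [N [_ uN]] := lR.
by apply: nMx; rewrite -(uN _ (max_idealP lR)) (uN _ mI).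
Qed.

(** Stands in for the finiteness of the minimal primes of I: every prime over I contains a member of
    [L]. In a maximal counterexample J, which is not prime, some xy lies in J, and the lists for J +
    (x) and J + (y) concatenate. The empty list serves the unit ideal. *)
Lemma prime_product I : ideal I -> exists L : seq (set R),
  [/\ forall i, (i < size L)%N -> prime_ideal (nth setT L i),
      forall i, (i < size L)%N -> I `<=` nth setT L i & prods L `<=` I].
Proof.
move=> iI; apply: contrapT => nL.
pose good I := exists L : seq (set R),
  [/\ forall i, (i < size L)%N -> prime_ideal (nth setT L i),
      forall i, (i < size L)%N -> I `<=` nth setT L i & prods L `<=` I].
have [|J [iJ bJ] maxJ] := @noetherian_max [set I | ideal I /\ ~ good I] I _ (conj iI nL).
  by move=> ? [].
have gJ x : ~ J x -> good (adj setT J x).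
  move=> Jx; apply: contrapT => bA; apply: Jx.
  rewrite -(maxJ (adj setT J x)); first exact: mem_adj.
    by split=> //; exact: ideal_adj.
  exact: sub_adj.
have [pJ|npJ] := pselect (prime_ideal J).
  apply: bJ; exists [:: J]; split.
  - by case=> //= _.
  - by case=> //= _; exact: subset_refl.
  - by move=> _ [x [_ [Jx -> ->]]]; rewrite mulr1.
apply: npJ; split=> //.
  by move=> J1; apply: bJ; exists [::]; split=> // x ->.
move=> x y Jxy; apply: contrapT => /not_orP[nJx nJy].
have [Lx [px sx Px]] := gJ x nJx; have [Ly [py sy Py]] := gJ y nJy.
apply: bJ; exists (Lx ++ Ly); rewrite size_cat; split.
- move=> i iL; rewrite nth_cat; case: ltnP => [|le]; first exact: px.
  by apply: py; rewrite ltn_subLR.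
- move=> i iL; rewrite nth_cat; case: ltnP => [lt|le].
    by apply: subset_trans (sx _ lt); exact: sub_adj.
  by apply: subset_trans (sy (i - size Lx)%N _); [exact: sub_adj|rewrite ltn_subLR].
- move=> _ /prods_cat[u [v [/Px[a [r [Ja _ ->]]] /Py[b [q [Jb _ ->]]] ->]]].
  have -> : (a + r * x) * (b + q * y) = (b + q * y) * a + (r * x) * b + r * q * (x * y) by ring.
  by apply: idealD; rewrite //; [apply: idealD; rewrite //|]; exact: idealMl.
Qed.

Lemma prime_prods P L : prime_ideal P -> prods L `<=` P ->
  exists2 i, (i < size L)%N & nth setT L i `<=` P.
Proof.
move=> pP; elim: L => [/(_ 1 erefl)/(primeN1 pP)//|Q L IH] LP.
have [QP|nQP] := pselect (Q `<=` P); first by exists 0%N.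
have [i iL LiP] : exists2 i, (i < size L)%N & nth setT L i `<=` P.
  apply: IH => y Ly; apply: contrapT => nPy; apply: nQP => x Qx.
  by case: (primeM pP (LP (x * y) _)) => //; exists x, y.
by exists i.+1.
Qed.

(** Some power of P R_P lies in I R_P. In a product of primes contained in I, a factor equal to P
    raises k; any other factor is not inside P, by minimality, and contributes to u an element
    outside P. *)
Lemma minimal_prime_pw I P : ideal I -> prime_ideal P ->
  (forall Q, prime_ideal Q -> I `<=` Q -> Q `<=` P -> Q = P) ->
  exists u k, ~ P u /\ forall y, pw P k y -> I (u * y).
Proof.
move=> iI pP minP; have [L [pL sL]] := prime_product iI.
suff [u [k [nu uL]]] : exists u k, ~ P u /\
    forall y, pw P k y -> prods L (u * y).
  by move=> LI; exists u, k; split=> // y /uL /LI.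
elim: L pL sL => [|Q L IH] pL sL.
  by exists 1, 0%N; split; [exact: (primeN1 pP)|move=> y ->; rewrite mulr1].
have [i iL|i iL|u [k [nu uL]]] := IH.
- exact: (pL i.+1 iL).
- exact: (sL i.+1 iL).
have [QP|/existsNP[q /not_implyP[Qq nPq]]] := pselect (Q `<=` P).
  have {}QP : Q = P by apply: minP => //; [exact: (pL 0%N)|exact: (sL 0%N)].
  exists u, k.+1; split=> // _ [x [y [Px Py ->]]].
  by exists x, (u * y); split; [rewrite QP|exact: uL|ring].
exists (q * u), k; split; first exact: prime_complM.
by move=> y Py; exists q, (u * y); split; [|exact: uL|ring].
Qed.

Lemma prime_avoidance I (L : seq (set R)) : ideal I ->
  (forall i, (i < size L)%N ->
     prime_ideal (nth setT L i) /\ ~ (I `<=` nth setT L i)) ->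
  exists2 x, I x & forall i, (i < size L)%N -> ~ nth setT L i x.
Proof.
move=> iI; elim: {L}(size L) {-2}L (leqnn (size L)) => [|n IH] [|Q L] // sL pL;
  try by exists 0; [exact: ideal0|].
have [pQ nIQ] := pL 0%N (ltn0Sn _).
(* Primes inside Q are avoided once Q is. Each remaining prime has an element outside Q, and the
   product of these elements yields a y in I and in all of them but not in Q; then x + y is the
   element sought when x lies in Q. *)
pose L' := [seq P <- L | ~~ `[< P `<=` Q >]].
have L'L i : (i < size L')%N -> [/\ prime_ideal (nth setT L' i),
    ~ (I `<=` nth setT L' i) & ~ (nth setT L' i `<=` Q)].
  move=> iL'; have PL := mem_nth setT iL'; move: PL; rewrite mem_filter.
  move=> /andP[/asboolPn ns /(nthP setT)[j jL E]].
  by have [] := pL j.+1 jL; rewrite /= E.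
have [||x Ix xL'] := IH L'.
- by rewrite size_filter -ltnS; exact: leq_ltn_trans (count_size _ _) sL.
- by move=> i /L'L[].
have LL' i z : (i < size (Q :: L))%N -> ~ Q z ->
    (forall i, (i < size L')%N -> ~ nth setT L' i z) -> ~ nth setT (Q :: L) i z.
  case: i => [//|i] /= iL nQz nL'z Pz.
  have [PQ|nPQ] := pselect (nth setT L i `<=` Q); first by apply: nQz; exact: PQ.
  have /(nthP setT)[j jL' E] : nth setT L i \in L'.
    by rewrite mem_filter mem_nth// andbT; exact/asboolPn.
  by apply: (nL'z j jL'); rewrite E.
have [Qx|nQx] := pselect (Q x); last by exists x => // i iL; exact: LL'.
have [y [Iy nQy yL']] : exists y, [/\ I y, ~ Q y &
    forall i, (i < size L')%N -> nth setT L' i y].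
  elim: (L') L'L => [|P K IHK] KP.
    by have /existsNP[y /not_implyP[Iy nQy]] := nIQ; exists y.
  have [i iK|y [Iy nQy yK]] := IHK; first exact: (KP i.+1 iK).
  have [pP _ /existsNP[p /not_implyP[Pp nQp]]] := KP 0%N (ltn0Sn _).
  exists (p * y); split.
  - exact: idealMl.
  - exact: prime_complM.
  - case=> [_|i iK]; first exact: (idealMr _ (prime_is_ideal pP)).
    have [pKi _ _] := KP i.+1 iK.
    exact: (idealMl _ (prime_is_ideal pKi) (yK i iK)).
exists (x + y); first exact: idealD.
move=> i iL; apply: LL' => // [Qxy|j jL' Pxy].
  apply: nQy; have -> : y = x + y - x by rewrite addrC addKr.
  by apply: idealB => //; exact: prime_is_ideal.
apply: (xL' j jL'); rewrite -(addrK y x).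
apply: idealB => //; last exact: yL'.
by apply: prime_is_ideal; have [] := L'L j jL'.
Qed.

(* If no such P' exists then R_P/(N,x) has finite length; the ideals
   sat_P(K n + (x)), with K n the n-th symbolic power of N + (y) at Q, then
   become stationary, and Nakayama's lemma gives K n = K n.+1. *)
Lemma principal_ideal_theorem N Q P x : prime_ideal N -> prime_ideal Q ->
  prime_ideal P -> N `<` Q -> Q `<` P -> P x ->
  exists P', [/\ prime_ideal P', N `<=` P', P' x & P' `<` P].
Proof.
move=> pN pQ pP [NQ /existsNP[y /not_implyP[Qy nNy]]] [QP nPQ] Px; apply: contrapT => nex.
have iN := prime_is_ideal pN; have iQ := prime_is_ideal pQ.
have iP := prime_is_ideal pP.
have nQx : ~ Q x by move=> Qx; apply: nex; exists Q; split.
pose I := adj setT N x; have iI : ideal I by exact: ideal_adj.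
have [P' pP' IP' P'P|u [k [nu uP]]] := minimal_prime_pw iI pP.
  apply: contrapT => ne; apply: nex; exists P'; split=> //.
  - by apply: subset_trans IP'; exact: sub_adj.
  - by apply: IP'; exact: mem_adj.
  - by split=> // PP'; apply: ne; apply/seteqP.
have [g Pg] := noethR iP.
have [B lB] := finite_length pP Pg iI nu uP.
pose K n := [set a | exists2 v, ~ Q v & exists b, N (v * a - b * y ^+ n)].
have iK n : ideal (K n).
  split.
  - by exists 1; [exact: (primeN1 pQ)|exists 0]; rewrite mulr0 mul0r subr0; exact: ideal0.
  - move=> a c [v nv [b Nb]] [w nw [d Nd]]; exists (v * w); first exact: prime_complM.
    exists (w * b + v * d).
    have -> : v * w * (a + c) - (w * b + v * d) * y ^+ n =
      w * (v * a - b * y ^+ n) + v * (w * c - d * y ^+ n) by ring.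
    by apply: idealD => //; exact: idealMl.
  - move=> a c [v nv [b Nb]]; exists v => //; exists (a * b).
    have -> : v * (a * c) - a * b * y ^+ n = a * (v * c - b * y ^+ n) by ring.
    exact: idealMl.
have NK n : N `<=` K n.
  move=> a Na; exists 1; first exact: (primeN1 pQ).
  by exists 0; rewrite mul1r mul0r subr0.
have mK n : K n.+1 `<=` K n.
  move=> a [v nv [b Nb]]; exists v => //; exists (b * y).
  by rewrite -mulrA -exprS.
have satK n : sat Q (K n) `<=` K n.
  move=> a [v nv [w nw [b Nb]]]; exists (w * v); first exact: prime_complM.
  by exists b; rewrite -mulrA.
pose J n := sat P (adj setT (K n) x).
have iA n : ideal (adj setT (K n) x) by exact: ideal_adj.
have [n nP] : exists n, forall k, (n <= k)%N -> J k = J n.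
  apply: (len_le_desc lB).
  - by move=> i; split; [exact: ideal_sat|exact: sat_sat].
  - move=> i; apply: subset_trans (sub_sat pP).
    apply: adj_sub => //; last exact: mem_adj.
    by apply: subset_trans (NK i) _; exact: sub_adj.
  - move=> i; apply: sat_mono; apply: adj_sub => //; last exact: mem_adj.
    by apply: subset_trans (mK i) _; exact: sub_adj.
have [h Kh] := noethR (iK n).
have KK : K n `<=` K n.+1.
  rewrite Kh; apply: seq_ideal_sub => // a ah.
  suff : sat P (K n.+1) a.
    by move=> [w nw Kw]; apply: satK; exists w => // /QP.
  apply: nakayama ah => // {}a ah.
  have Ka : K n a by rewrite Kh; exact: mem_seq_ideal.
  have : J n a by apply: sub_sat => //; exact: sub_adj.
  rewrite -(nP n.+1 (leqnSn n)) => -[w nw [b [c [Kb _ E]]]]; exists w => //.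
  rewrite E; have iAh := ideal_adjs h iP (iK n.+1).
  apply: idealD => //; first exact: sub_adjs.
  (* Since x is outside Q and [K n] is saturated at Q, cx in [K n] gives c in [K n]. So a multiple
     of a by an element outside P lies in [K n.+1] + x [K n] with x in P, as Nakayama's lemma
     requires. *)
  have {b Kb E}: K n c.
    have Kcx : K n (c * x).
      have -> : c * x = w * a - b by rewrite E addrC addKr.
      by apply: idealB; rewrite //; [exact: idealMl|exact: mK].
    by apply: satK; exists x => //; rewrite mulrC.
  rewrite Kh => hc.
  have iC : ideal [set c | adjs P (K n.+1) h (c * x)].
    split=> /= [|d e dx ex|d e ex].
    - by rewrite mul0r; exact: ideal0.
    - by rewrite mulrDl; exact: idealD.
    - by rewrite -mulrA; exact: idealMl.
  apply: (seq_ideal_sub iC _ hc) => d dh /=; rewrite mulrC.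
  exact: mem_adjsM.
(* Now v y^n = b y^(n+1) modulo N with v outside Q. As N is prime and omits y, v - by lies in N,
   hence in Q; but y is in Q, so v would be too. *)
have [v nv [b Nb]] : K n.+1 (y ^+ n).
  apply: KK; exists 1; first exact: (primeN1 pQ).
  by exists 1; rewrite subrr; exact: ideal0.
have : N ((v - b * y) * y ^+ n) by rewrite mulrBl -mulrA -exprS.
move=> /(primeM pN)[/NQ Qv|/(primeX pN)//]; apply: nv.
by rewrite -(subrK (b * y) v); apply: idealD => //; exact: idealMl.
Qed.

(** * Chains of primes and Krull's height theorem *)

Fixpoint pchain N n P : Prop :=
  if n is n'.+1 then exists Q, [/\ prime_ideal Q, pchain N n' Q & Q `<` P]
  else N = P.

Lemma pchain_sub N n P : pchain N n P -> N `<=` P.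
Proof.
elim: n P => [|n IH] P /=; first by move=> ->.
by move=> [Q [_ /IH NQ [QP _]]]; exact: subset_trans QP.
Qed.

Lemma pchain_cons N Q n P : prime_ideal Q -> N `<` Q -> pchain Q n P ->
  prime_ideal N -> pchain N n.+1 P.
Proof.
move=> pQ NQ + pN; elim: n P => [|n IH] P /=.
  by move=> <-; exists N; split.
by move=> [Q' [pQ' c Q'P]]; exists Q'; split=> //; exact: IH.
Qed.

(** The element x is pushed down the chain: in a piece Q2 < Q1 < P with x in P but not in Q2, the
    principal ideal theorem replaces Q1 by a prime containing x. At the bottom link, N is dropped,
    which costs one step. *)
Lemma pchain_through N n P x : prime_ideal N -> prime_ideal P -> P x ->
  pchain N n.+1 P ->
  exists Q, [/\ prime_ideal Q, N `<=` Q, Q x & pchain Q n P].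
Proof.
move=> pN; elim: n P => [|n IH] P pP Px.
  move=> [Q [_ /= -> []]] QP _; exists P; split=> //.
move=> [Q1 [pQ1 [Q2 [pQ2 cQ2 Q21] Q1P]]].
have [P' [pP' Q2P' P'x P'P]] := principal_ideal_theorem pQ2 pQ1 pP Q21 Q1P Px.
have [Q2x|nQ2x] := pselect (Q2 x).
  have [||Q [pQ NQ Qx cQ]] := IH Q1 pQ1; first by case: Q21 => H _; exact: H.
    by exists Q2; split.
  by exists Q; split=> //; exists Q1; split.
have [|Q [pQ NQ Qx cQ]] := IH P' pP' P'x.
  by exists Q2; split=> //; split=> // P'Q2; apply: nQ2x; exact: P'Q2.
by exists Q; split=> //; exists P'; split.
Qed.

(** The base prime N makes the induction on [s] possible: after using x, the remaining elements are
    taken over the prime Q containing x that starts the shortened chain. *)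
Lemma height_theorem s N n P : prime_ideal N -> prime_ideal P ->
  (forall x, x \in s -> P x) ->
  (forall Q, prime_ideal Q -> N `<=` Q -> (forall x, x \in s -> Q x) ->
     Q `<=` P -> Q = P) ->
  pchain N n P -> (n <= size s)%N.
Proof.
move=> + pP; elim: s N n => [|x s IH] N [|n] // pN sP minP c.
  have NP := pchain_sub c.
  case: c => Q [pQ /pchain_sub NQ [QP []]].
  by rewrite -(minP N).
have [Q [pQ NQ Qx cQ]] := pchain_through pN pP (sP x (mem_head x s)) c.
apply: (IH Q) => // [y ys|Q' pQ' QQ' sQ' Q'P].
  by apply: sP; rewrite inE ys orbT.
apply: minP => //; first exact: subset_trans QQ'.
by move=> y; rewrite inE => /orP[/eqP->|/sQ'//]; exact: QQ'.
Qed.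

Lemma strict_chain_pchain (J : nat -> set R) n :
  (forall i, (i <= n)%N -> prime_ideal (J i)) ->
  (forall i, (i < n)%N -> J i `<` J i.+1) -> pchain (J 0%N) n (J n).
Proof.
elim: n => //= n IH pJ sJ; exists (J n); split; [exact: pJ| |exact: sJ].
by apply: IH => i ni; [apply: pJ|apply: sJ]; exact: leq_trans ni _.
Qed.

Lemma pchain_strict_chain N n P : prime_ideal P -> pchain N n P ->
  strict_chain (@prime_ideal R) n.
Proof.
move=> pP c; suff [J [pJ sJ _]] : exists J : nat -> set R,
    [/\ forall i, (i <= n)%N -> prime_ideal (J i),
        forall i, (i < n)%N -> J i `<` J i.+1 & J n = P] by exists J.
elim: n P pP c => [|n IH] P pP /=; first by exists (fun=> P).
move=> [Q [pQ /(IH Q pQ)[J [pJ sJ Jn]] QP]].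
exists (fun i => if (i <= n)%N then J i else P); split.
- by move=> i _; case: ifP => // /pJ.
- move=> i ni; have {}ni : (i <= n)%N by []; rewrite ni.
  case: ltnP => [/sJ//|ni']; have -> : i = n by apply/eqP; rewrite eqn_leq ni.
  by rewrite Jn.
- by rewrite ltnn.
Qed.

(** The existence half of dimension theory: if fewer than r elements never make M nilpotent modulo
    I, a chain of length r over I exists. By prime avoidance x is chosen in M outside every prime of
    a product for I other than M, and the induction continues over I + (x). *)
Lemma prime_chain_exists M I r : local_at M -> ideal I -> I `<=` M ->
  (forall s k, (size s < r)%N -> (forall x, x \in s -> M x) ->
     ~ (pw M k `<=` adjs setT I s)) ->
  exists N, [/\ prime_ideal N, I `<=` N & pchain N r M].
Proof.
move=> lM; have pM := local_at_prime lM; have iM := prime_is_ideal pM.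
elim: r I => [|r IH] I iI IM nI; first by exists M; split.
have [L [pL sL LI]] := prime_product iI.
pose L' := [seq P <- L | P != M].
have sub_max P : prime_ideal P -> P `<=` M.
  by move=> pP; apply: proper_sub_local_at => //; [exact: prime_is_ideal|exact: primeN1].
have L'L P : P \in L' -> [/\ prime_ideal P, I `<=` P & P `<` M].
  rewrite mem_filter => /andP[/eqP ne /(nthP setT)[i iL E]].
  have pP : prime_ideal P by rewrite -E; exact: pL.
  split=> //; first by rewrite -E; exact: sL.
  by split=> [|MP]; [exact: sub_max|apply: ne; apply/seteqP; split=> //; exact: sub_max].
have [i iL'|x Mx xL'] := prime_avoidance (L := L') iM.
  by have [pP _ []] := L'L _ (mem_nth setT iL').
have [|| |P1 [pP1 IP1 c]] := IH (adj setT I x).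
- exact: ideal_adj.
- exact: adj_sub.
- move=> s k sr sM; have := nI (s ++ [:: x]) k; rewrite /adjs foldr_cat; apply.
    by rewrite size_cat addn1.
  by move=> y; rewrite mem_cat !inE => /orP[/sM//|/eqP->].
have P1x : P1 x by apply: IP1; exact: mem_adj.
have {}IP1 : I `<=` P1 by apply: subset_trans IP1; exact: sub_adj.
have [i iL LiP1] := prime_prods pP1 (subset_trans LI IP1).
(* A prime of [L] inside P1 and other than M lies strictly below P1, as it omits x. If it is M, then
   P1 = M, the chain from P1 is trivial and any member of [L'] will do; one exists, since otherwise
   [L] would put a power of M inside I. *)
have [E|ne] := eqVneq (nth setT L i) M; last first.
  set Q := nth setT L i in LiP1 ne.
  have QL' : Q \in L' by rewrite mem_filter ne mem_nth.
  have [pQ IQ _] := L'L _ QL'; exists Q; split=> //.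
  apply: pchain_cons c _ => //; split=> // P1Q.
  have /(nthP setT)[j jL' EQ] := QL'.
  by apply: (xL' j jL'); rewrite EQ; exact: P1Q.
have P1M : P1 = M by apply/seteqP; split; [exact: sub_max|rewrite -E].
have [Q QL'] : exists Q, Q \in L'.
  apply: contrapT => nQ; apply: (nI [::] (size L)) => //=.
  suff <- : L = nseq (size L) M by [].
  apply/all_pred1P/allP => P PL /=; apply: contrapT => /negP ne; apply: nQ.
  by exists P; rewrite mem_filter ne.
have [pQ IQ QM] := L'L Q QL'; exists Q; split=> //.
case: (r) c => [_|r' /=]; first by exists Q.
by rewrite P1M => -[Q' [_ /pchain_sub MQ' [_ []]]].
Qed.

End Noetherian.

(** * Length, geometric dimension and parameter degree *)

Lemma sup_natP (P : set nat) l n0 : P n0 ->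
  sup_nat P = Some l <-> P l /\ forall n, P n -> (n <= l)%N.
Proof.
move=> P0; rewrite /sup_nat; split=> [/min_natP /= [ub lub]|[Pl ub]]; last first.
  by apply/min_natP; split=> // k; exact.
split=> //; apply: contrapT => nPl.
have lt n : P n -> (n < l)%N.
  by move=> Pn; rewrite ltn_neqAle ub// andbT; apply/eqP => E; apply: nPl; rewrite -E.
have /lub : forall n, P n -> (n <= l.-1)%N.
  by move=> n /lt nl; rewrite -ltnS prednK//; exact: leq_ltn_trans nl.
by rewrite leqNgt prednK ?leqnn//; exact: leq_ltn_trans (lt _ P0).
Qed.

Lemma min_nat_ex (P : set nat) n : P n -> exists d, min_nat P = Some d.
Proof.
move=> Pn; case E: (min_nat P) => [d|]; first by exists d.
by have /(_ n) := (min_nat_None P).1 E.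
Qed.

(** * Ideals of a quotient ring *)

Section Quotient.
Variables (R : comPzRingType) (A : set R).
Implicit Types (I : set R) (J : set (quot_ring A)).

Definition qpi (x : R) : quot_ring A := \pi_(quot_ring A)%qT x.

Lemma qpiD x y : qpi (x + y) = qpi x + qpi y.
Proof. exact: quot_pi_add. Qed.

Lemma qpiM x y : qpi (x * y) = qpi x * qpi y.
Proof. exact: quot_pi_mul. Qed.

Lemma qpi1 : qpi 1 = 1. Proof. by []. Qed.

Lemma qpi_surj u : exists x, u = qpi x.
Proof. by exists (repr u); rewrite /qpi reprK. Qed.

Lemma qpi_eq x y : qpi x = qpi y <-> ideal_gen A (x - y).
Proof. exact: quot_piE. Qed.

Lemma qpi0 : qpi 0 = 0.
Proof. by apply: (addrI (qpi 0)); rewrite -qpiD !addr0. Qed.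

Lemma qpi_eq0 x : qpi x = 0 <-> ideal_gen A x.
Proof. by rewrite -qpi0 qpi_eq subr0. Qed.

Lemma ideal_preim J : ideal J -> ideal (qpi @^-1` J).
Proof.
move=> iJ; split=> [|x y Jx Jy|a x Jx] /=.
- by rewrite qpi0; exact: ideal0.
- by rewrite qpiD; exact: idealD.
- by rewrite qpiM; exact: idealMl.
Qed.

Lemma sub_preim J : ideal J -> A `<=` qpi @^-1` J.
Proof.
move=> iJ x Ax /=; rewrite (qpi_eq0 x).2; first exact: ideal0.
by move=> I [_]; apply.
Qed.

Lemma preim_inj J J' : qpi @^-1` J = qpi @^-1` J' -> J = J'.
Proof.
move=> E; apply/seteqP; split=> u; have [x ->] := qpi_surj u => Jx.
  by have : (qpi @^-1` J) x by []; rewrite E.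
by have : (qpi @^-1` J') x by []; rewrite -E.
Qed.

Lemma ideal_image I : ideal I -> ideal (qpi @` I).
Proof.
move=> iI; split.
- by exists 0; [exact: ideal0|exact: qpi0].
- by move=> _ _ [x Ix <-] [y Iy <-]; exists (x + y); [exact: idealD|rewrite qpiD].
- move=> u _ [x Ix <-]; have [a ->] := qpi_surj u.
  by exists (a * x); [exact: idealMl|rewrite qpiM].
Qed.

Lemma preim_image I : ideal I -> A `<=` I -> qpi @^-1` (qpi @` I) = I.
Proof.
move=> iI AI; apply/seteqP; split=> [x [y Iy /qpi_eq yx]|x Ix]; last by exists x.
rewrite -[x](subKr y); apply: idealB => //.
by apply: smallest_sub yx.
Qed.

Lemma quot_chain n : strict_chain (@ideal (quot_ring A)) n <->
  strict_chain [set I | ideal I /\ A `<=` I] n.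
Proof.
split=> -[J [iJ sJ]].
  exists (fun i => qpi @^-1` J i); split=> i ni.
    by split; [apply: ideal_preim; exact: iJ|apply: sub_preim; exact: iJ].
  have [JJ nJJ] := sJ i ni; split=> [x /JJ//|H]; apply: nJJ => u.
  by have [x ->] := qpi_surj u; exact: H.
exists (fun i => qpi @` J i); split=> i ni.
  by have [? _] := iJ i ni; exact: ideal_image.
have [JJ nJJ] := sJ i ni; split=> [_ [x Jx <-]|H]; first by exists x => //; exact: JJ.
have [iJi AJi] := iJ i (ltnW ni).
apply: nJJ => x Jx; rewrite -(preim_image iJi AJi); apply: H.
by exists x.
Qed.

End Quotient.

(** * Length measured by sequences of elements *)

Section Length.
Variable R : comPzRingType.
Implicit Types (s t : seq R) (M I : set R).

Fixpoint chainseq s t : Prop :=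
  if t is a :: t' then ~ seq_ideal s a /\ chainseq (a :: s) t' else True.

Lemma chainseqP s n : strict_chain (@ideal (quot_ring [set` s])) n <->
  exists2 t, size t = n & chainseq s t.
Proof.
rewrite quot_chain; split=> [[J [iJ sJ]]|[t <- st]].
  have {iJ}[iJ sJ0] : (forall i, (i <= n)%N -> ideal (J i)) /\
      (forall x, x \in s -> J 0%N x).
    by split=> [i /iJ[]//|x xs]; have [_] := iJ 0%N (leq0n n); exact.
  elim: n s J iJ sJ sJ0 => [|n IH] s J iJ sJ sJ0; first by exists [::].
  have [J01 /existsNP[a /not_implyP[Ja nJa]]] := sJ 0%N (ltn0Sn n).
  have [||x xas|t tn ct] := IH (a :: s) (fun i => J i.+1).
  - by move=> i ni; exact: iJ.
  - by move=> i ni; exact: sJ.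
  - by move: xas; rewrite inE => /orP[/eqP->//|/sJ0]; exact: J01.
  exists (a :: t); first by rewrite /= tn.
  by split=> // sa; apply: nJa; apply: seq_ideal_sub sa => //; exact: iJ.
have [J [iJ sJ mJ _]] : exists J : nat -> set R,
    [/\ forall i, (i <= size t)%N -> ideal (J i),
        forall i, (i <= size t)%N -> seq_ideal s `<=` J i,
        forall i, (i < size t)%N -> J i `<` J i.+1 & J 0%N = seq_ideal s].
  elim: t s st => [|a t IH] s /=.
    by move=> _; exists (fun=> seq_ideal s); split=> // i _; [exact: ideal_seq|exact: subset_refl].
  move=> [nsa /IH[J [iJ asJ sJ J0]]].
  exists (fun i => if i is j.+1 then J j else seq_ideal s).
  have sas : seq_ideal s `<=` seq_ideal (a :: s).
    by rewrite seq_ideal_cons; exact: sub_adj.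
  split=> // -[|i] //= ni.
  - exact: ideal_seq.
  - exact: iJ.
  - exact: subset_refl.
  - exact: subset_trans (asJ _ ni).
  - rewrite J0; split=> // /(_ a) H; apply: nsa; apply: H.
    by apply: mem_seq_ideal; exact: mem_head.
  - exact: sJ.
exists J; split=> // i ni; split; first exact: iJ.
by apply: subset_trans (sJ i ni) => x; exact: mem_seq_ideal.
Qed.

Definition has_length s l :=
  (exists2 t, size t = l & chainseq s t) /\ forall t, chainseq s t -> (size t <= l)%N.

Lemma ring_lengthP s l :
  ring_length (quot_ring [set` s]) = Some l <-> has_length s l.
Proof.
rewrite /ring_length (@sup_natP _ _ 0%N); last by apply/chainseqP; exists [::].
rewrite chainseqP; split=> -[lt ub]; split=> //.
  by move=> t st; apply: ub; apply/chainseqP; exists t.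
by move=> n /chainseqP[t <-]; exact: ub.
Qed.

End Length.

(** * Local rings with finitely generated maximal ideal *)

Section LocalFG.
Variables (R : comPzRingType) (M : set R) (g : seq R).
Hypotheses (lM : local_at M) (Mg : M = seq_ideal g).
Implicit Types (s t : seq R).

Let iM : ideal M := local_at_ideal lM.
Let pM : prime_ideal M := local_at_prime lM.

(** Nakayama's lemma for the ideal M^n modulo (s): if M^n lies in (s) + M^(n+1), it lies in (s).
    Only finite generation of M enters. *)
Lemma pw_seq_nakayama s n : (forall x, x \in mons n g -> seq_ideal (s ++ mons n.+1 g) x) ->
  pw M n `<=` seq_ideal s.
Proof.
move=> H; have iK := ideal_seq s.
suff mK x : x \in mons n g -> seq_ideal s x.
  by move=> y; rewrite {1}Mg => /pw_mons; apply: seq_ideal_sub.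
rewrite -(local_at_sat lM iK); apply: nakayama => // {}x /H xn.
have iA : ideal (adjs M (seq_ideal s) (mons n g)) by exact: ideal_adjs.
apply: sub_sat => //; apply: (seq_ideal_sub iA _ xn) => y.
rewrite mem_cat => /orP[ys|/flatten_mapP[p pg /mapP[z zn ->]]].
  by apply: sub_adjs => //; exact: mem_seq_ideal.
have Mp : M p by rewrite Mg; exact: mem_seq_ideal.
exact: mem_adjsM.
Qed.

(** Forwards, the descending ideals (s) + M^n become stationary and Nakayama's lemma applies.
    Backwards, the exponent k bounds the length, hence every descending chain. *)
Lemma artinianP s :
  artinian (quot_ring [set` s]) <-> exists k, pw M k `<=` seq_ideal s.
Proof.
split=> [art|[k Mk]].
  pose J n := @qpi _ [set` s] @` seq_ideal (s ++ mons n g).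
  have [||n nP] := art J.
  - by move=> n; apply: ideal_image; exact: ideal_seq.
  - move=> n; apply: image_subset; apply: seq_ideal_sub; first exact: ideal_seq.
    move=> x; rewrite mem_cat => /orP[xs|/flatten_mapP[p pg /mapP[z zn ->]]].
      by apply: mem_seq_ideal; rewrite mem_cat xs.
    apply: (idealMl _ (ideal_seq _)); apply: mem_seq_ideal.
    by rewrite mem_cat zn orbT.
  exists n; apply: pw_seq_nakayama => x xn.
  have AI : [set` s] `<=` seq_ideal (s ++ mons n.+1 g).
    by move=> y /= ys; apply: mem_seq_ideal; rewrite mem_cat ys.
  rewrite -(preim_image (ideal_seq _) AI) /=.
  have : J n (qpi [set` s] x).
    by exists x => //; apply: mem_seq_ideal; rewrite mem_cat xn orbT.
  by rewrite -(nP n.+1 (leqnSn n)).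
have [|N lN] := finite_length pM Mg (ideal_seq s) (u := 1) (k := k) (primeN1 pM).
  by move=> y /Mk; rewrite mul1r.
move=> J iJ dJ.
have [|||n nP] := len_le_desc (J := fun i => qpi [set` s] @^-1` J i) lN.
- move=> i; have iP := ideal_preim (iJ i).
  by split=> //; rewrite local_at_sat.
- move=> i; apply: seq_ideal_sub; first exact: ideal_preim.
  by move=> x; exact: (sub_preim (iJ i)).
- by move=> i x; exact: dJ.
by exists n => j nj; apply: (@preim_inj _ [set` s]); exact: nP.
Qed.

(** By [artinianP], the sequences over which the geometric dimension minimizes; their size is not
    fixed. *)
Definition param s := (forall x, x \in s -> M x) /\ exists k, pw M k `<=` seq_ideal s.

Lemma gdimP d : gdim R = Some d <->
  (exists2 s, size s = d & param s) /\ forall s, param s -> (d <= size s)%N.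
Proof.
rewrite /gdim min_natP (local_at_max lM); split=> -[[s sd [sM]]].
  move=> /artinianP sk min; split; first by exists s.
  by move=> t [tM /artinianP at_]; apply: min; exists t.
move=> /artinianP sa min; split; first by exists s.
by move=> _ [t <- [tM /artinianP at_]]; exact: min.
Qed.

Lemma param_generators : param g.
Proof.
split=> [x xg|]; first by rewrite Mg; exact: mem_seq_ideal.
by exists 1%N => _ [x [_ [Mx -> ->]]]; rewrite mulr1 -Mg.
Qed.

Lemma gdim_ex : exists d, gdim R = Some d.
Proof.
apply: (min_nat_ex (n := size g)); exists g => //.
have [gM gk] := param_generators; rewrite (local_at_max lM).
by split=> //; exact/artinianP.
Qed.

(** Length l gives the uniform exponent l. If x_1...x_l y is outside (s), then adjoining in turn
    x_1...x_l y, x_2...x_l y, ..., y gives l + 1 strict steps: a relation z'y = a + r x z'y would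
    put z'y in (s), because 1 - rx is a unit. The spare factor y is there for the induction. *)
Lemma has_length_pw s l : has_length s l -> pw M l `<=` seq_ideal s.
Proof.
move=> [_ ub] z Mz; apply: contrapT => nsz.
suff [t tl ct] : exists2 t, size t = l.+1 & chainseq s t.
  by have := ub t ct; rewrite tl ltnn.
have {nsz} : ~ seq_ideal s (z * 1) by rewrite mulr1.
elim: l s z (1 : R) Mz {ub} => [|l IH] s z y /=.
  by move=> ->; rewrite mul1r => nsy; exists [:: y].
move=> [x [z' [Mx Mz' ->]]] nsy.
have [|t tl ct] := IH (x * z' * y :: s) z' y Mz'; last by exists (x * z' * y :: t); rewrite /= ?tl.
rewrite seq_ideal_cons => -[a [r [sa _ E]]]; apply: nsy.
have iS := ideal_seq s; rewrite -mulrA; apply: (idealMl _ iS).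
rewrite -(local_at_sat lM iS); exists (1 - r * x).
  move=> M1; apply: (primeN1 pM); rewrite -(subrK (r * x) 1).
  by apply: idealD => //; exact: idealMl.
have -> : (1 - r * x) * (z' * y) = z' * y - r * (x * z' * y) by ring.
by rewrite {1}E addrK.
Qed.

Lemma has_length_ex s : param s -> exists l, has_length s l.
Proof.
move=> [sM [k Mk]].
have [|N lN] := finite_length pM Mg (ideal_seq s) (u := 1) (k := k) (primeN1 pM).
  by move=> y /Mk; rewrite mul1r.
have ub n : strict_chain (@ideal (quot_ring [set` s])) n -> (n <= N)%N.
  move=> /quot_chain[J [iJ sJ]]; apply: (len_le_chain (J := J) lN) => // i ni.
    by have [iJi _] := iJ i ni; split=> //; rewrite local_at_sat.
  by have [iJi sJi] := iJ i ni; apply: seq_ideal_sub.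
have [l E] : exists l, ring_length (quot_ring [set` s]) = Some l.
  exact: (min_nat_ex (n := N)).
by exists l; exact/ring_lengthP.
Qed.

(** Only sequences of finite length enter the parameter degree. The length supplies an exponent at
    once, which links the radical in the definition to [param]. *)
Lemma generic_seqP s l : has_length s l ->
  generic_seq s <-> gdim R = Some (size s) /\ param s.
Proof.
move=> sl; rewrite /generic_seq /max_primary (local_at_max lM).
have sk := has_length_pw sl.
split=> -[-> H]; split=> //.
  move: H => [_ rs]; split; last by exists l.
  by move=> x xs; rewrite -rs; exists 1%N; rewrite expr1; exact: mem_seq_ideal.
have [sM _] := H.
have sM' : seq_ideal s `<=` M by apply: seq_ideal_sub.
have rs : radical (seq_ideal s) = M.
  apply/seteqP; split=> x; first by move=> [n /sM' /(primeX pM)].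
  by move=> Mx; exists l; apply: sk; exact: pw_exp.
split=> //; split.
- exact: ideal_seq.
- by move=> /sM'; exact: primeN1.
move=> x y sxy; have [My|nMy] := pselect (M y).
  by right; exists l; apply: sk; exact: pw_exp.
left; rewrite -(local_at_sat lM (ideal_seq s)); exists y => //.
by rewrite mulrC.
Qed.

Lemma parameter_degreeP p : parameter_degree R = Some p <->
  (exists s, [/\ gdim R = Some (size s), param s & has_length s p]) /\
  forall s l, gdim R = Some (size s) -> param s -> has_length s l -> (p <= l)%N.
Proof.
rewrite /parameter_degree min_natP; split=> -[].
  move=> [s gs /ring_lengthP sl] min; split.
    by exists s; have [] := (generic_seqP sl).1 gs.
  move=> t l gt pt tl; apply: min; exists t; last exact/ring_lengthP.
  exact/(generic_seqP tl).
move=> [s [gs ps sl]] min; split.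
  by exists s; [exact/(generic_seqP sl)|exact/ring_lengthP].
by move=> l [t + /ring_lengthP tl] => /(generic_seqP tl)[gt pt]; exact: (min t).
Qed.

Lemma parameter_degree_ex : exists p, parameter_degree R = Some p.
Proof.
have [d gd] := gdim_ex; have [[s sd ps] _] := (gdimP d).1 gd.
have [l sl] := has_length_ex ps.
apply: (min_nat_ex (n := l)); exists s; last exact/ring_lengthP.
by apply/(generic_seqP sl); rewrite sd.
Qed.

End LocalFG.

Lemma noetherian_max_generators (R : comPzRingType) (M : set R) :
  noetherian R -> local_at M -> exists g, M = seq_ideal g.
Proof. by move=> nR [/nR]. Qed.

Lemma krull_dim_gdim (R : comPzRingType) :
  local_ring R -> noetherian R -> krull_dim R = gdim R.
Proof.
move=> lR nR; have lM := noetherian_local_at nR lR; set M := max_ideal R in lM.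
have pM := local_at_prime lM; have iM := local_at_ideal lM.
have [g Mg] := noetherian_max_generators nR lM.
have [d gd] := gdim_ex lM Mg; have [[s sd [sM [k sk]]] min] := (gdimP lM Mg d).1 gd.
have sub_max P : prime_ideal P -> P `<=` M.
  by move=> pP; apply: proper_sub_local_at => //; [exact: prime_is_ideal|exact: primeN1].
have uniq Q : prime_ideal Q -> (forall x, x \in s -> Q x) -> Q = M.
  move=> pQ sQ; apply/seteqP; split; first exact: sub_max.
  move=> x Mx; apply: (primeX (n := k) pQ).
  have iQ := prime_is_ideal pQ.
  by apply: (seq_ideal_sub iQ sQ); apply: sk; exact: pw_exp.
rewrite gd /krull_dim (@sup_natP _ _ 0%N); last by exists (fun=> M).
split.
  have [| |N [pN _ c]] := prime_chain_exists nR (I := [set 0]) (r := d) lM (@ideal_set0 R).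
  - by move=> _ ->; exact: ideal0.
  - move=> t j td tM tj; have := min t; rewrite leqNgt td; move/(_ _)/notF; apply.
    by split=> //; exists j; rewrite seq_idealE.
  exact: pchain_strict_chain c.
move=> n [J [pJ sJ]]; have c := strict_chain_pchain pJ sJ.
have pJ0 := pJ 0%N (leq0n n); rewrite -sd.
have [E|ne] := pselect (J n = M).
  by rewrite E in c; apply: height_theorem c => // Q pQ _ sQ _; exact: uniq.
(* A chain that stops short of M is extended by M, and the bound is applied to length n + 1. *)
apply: leq_trans (leqnSn n) _.
apply: (height_theorem nR (P := M) (N := J 0%N)) => //.
  by move=> Q pQ _ sQ _; exact: uniq.
exists (J n); split=> //; first exact: pJ.
split; first by apply: sub_max; exact: pJ.
by move=> MJ; apply: ne; apply/seteqP; split=> //; apply: sub_max; exact: pJ.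
Qed.

(** * Ultraproducts *)

Section Associated.
Variable R : comPzRingType.
Implicit Types (M I : set R) (s t : seq R).

Lemma ideal_colon I a : ideal I -> ideal (colon I a).
Proof.
move=> iI; split=> [|x y Ix Iy|b x Ix]; rewrite /colon/=.
- by rewrite mul0r; exact: ideal0.
- by rewrite mulrDl; exact: idealD.
- by rewrite -mulrA; exact: idealMl.
Qed.

(* Socle argument: a lies in M^k but not in (s), where M^(k+1) is in (s). *)
Lemma max_ideal_colon M s : local_at M -> param M s ->
  exists a, colon (seq_ideal s) a = M.
Proof.
move=> lM [sM [k0 k0P]]; have iM := local_at_ideal lM.
have exk : exists k, `[< pw M k `<=` seq_ideal s >] by exists k0; exact/asboolP.
have [[|k] /asboolP kP kmin] := ex_minnP exk.
  case: (primeN1 (local_at_prime lM)); have /(_ 1 erefl) := kP.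
  exact: seq_ideal_sub.
have /existsNP[z /not_implyP[kz nsz]] : ~ pw M k `<=` seq_ideal s.
  by move=> /asboolP/kmin; rewrite ltnn.
exists z; apply/seteqP; split.
  apply: proper_sub_local_at => //; first exact/ideal_colon/ideal_seq.
  by rewrite /colon /= mul1r.
by move=> x Mx; apply: kP; exists x, z.
Qed.

(** Some prime over I differs from M, since otherwise I would contain a power of M; so some z in M
    has no power in I. A colon ideal (I : b) maximal under the condition that no z^n b lies in I is
    prime and omits z. *)
Lemma associated_prime_exists M I : noetherian R -> local_at M -> ideal I ->
  (forall k, ~ pw M k `<=` I) ->
  exists b z, [/\ prime_ideal (colon I b), M z & ~ colon I b z].
Proof.
move=> nR lM iI nMI; have [L [pL sL LI]] := prime_product nR iI.
have [P [pP IP PM]] : exists P, [/\ prime_ideal P, I `<=` P & P <> M].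
  apply: contrapT => nex; apply: (nMI (size L)).
  suff <- : L = nseq (size L) M by [].
  apply/all_pred1P/allP => P /(nthP setT)[i iL <-] /=.
  apply: contrapT => ne; apply: nex; exists (nth setT L i).
  by split; [exact: pL|exact: sL|move/eqP].
have [z Mz nPz] : exists2 z, M z & ~ P z.
  apply: contrapT => nz; apply: PM; apply/seteqP; split.
    by apply: proper_sub_local_at => //; [exact: prime_is_ideal|exact: primeN1].
  by move=> z Mz; apply: contrapT => nPz; apply: nz; exists z.
pose F := [set J | exists2 b, J = colon I b & forall n, ~ I (z ^+ n * b)].
have F1 : F (colon I 1).
  by exists 1 => // n; rewrite mulr1 => /IP/(primeX pP).
have [|_ [b -> nb] maxF] := noetherian_max nR _ F1.
  by move=> _ [b -> _]; exact: ideal_colon.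
exists b, z; split=> //; last by have := nb 1%N; rewrite expr1.
split; first exact: ideal_colon.
  by have := nb 0%N; rewrite expr0.
move=> x y bxy; apply: contrapT => /not_orP[nx ny].
(* The ideal (I : ub) contains (I : b) and also v, so by maximality it violates the condition.
   Applied to x, this makes (I : z^n b) contain x; that ideal satisfies the condition, hence equals
   (I : b). *)
have step u v : colon I b (u * v) -> ~ colon I b v -> exists n, I (z ^+ n * (u * b)).
  move=> buv nv; apply: contrapT => nex; apply: nv.
  rewrite -(maxF (colon I (u * b))).
  - by rewrite /colon /= mulrCA mulrA.
  - by exists (u * b) => // n Iz; apply: nex; exists n.
  - by move=> w; rewrite /colon /= mulrCA; exact: idealMl.
have [n Iy] : exists n, I (z ^+ n * (x * b)) by exact: (step x y).
apply: nx; rewrite -(maxF (colon I (z ^+ n * b))).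
- by rewrite /colon /= mulrCA.
- by exists (z ^+ n * b) => // m; rewrite mulrA -exprD; exact: nb.
- by move=> w; rewrite /colon /= mulrCA; exact: idealMl.
Qed.

End Associated.

Section ChainseqTake.
Variable R : comPzRingType.
Implicit Types s t : seq R.

Definition has_chain s n := exists2 t, size t = n & chainseq s t.

Lemma chainseq_take n s t : chainseq s t -> chainseq s (take n t).
Proof. by elim: t n s => [|a t IH] [|n] s //= [nsa /IH]. Qed.

(** Chains can be truncated, so two chain conditions of fixed size determine the length; each of
    them transfers. *)
Lemma has_lengthP s l : has_length s l <-> has_chain s l /\ ~ has_chain s l.+1.
Proof.
split=> -[cl H]; split=> //.
  by move=> [t tl /H]; rewrite tl ltnn.
move=> t ct; rewrite leqNgt; apply/negP => lt; apply: H.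
by exists (take l.+1 t); [exact: size_takel|exact: chainseq_take].
Qed.

End ChainseqTake.

(** * Transfer between the ultraproduct and almost all factors *)

Section Ultra.
Variables (W : Type) (U : set_system W).
Hypothesis hU : UltraFilter U.

Let pU : ProperFilter U := ultra_proper.

Lemma near_not (P : W -> Prop) :
  ~ (\forall w \near U, P w) <-> \forall w \near U, ~ P w.
Proof.
split=> [nP|nP uP].
  by have [] := in_ultra_setVsetC [set w | P w] hU.
apply: (@filter_not_empty _ U); apply: filterS2 nP uP.
by move=> w nPw /nPw.
Qed.

Lemma near_and (P Q : W -> Prop) : (\forall w \near U, P w) ->
  (\forall w \near U, Q w) -> \forall w \near U, P w /\ Q w.
Proof. exact: filterI. Qed.

Lemma near_or (P Q : W -> Prop) : (\forall w \near U, P w \/ Q w) ->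
  (\forall w \near U, P w) \/ (\forall w \near U, Q w).
Proof.
move=> PQ; have [|/near_not nP] := pselect (\forall w \near U, P w); first by left.
by right; apply: filterS2 PQ nP => w [].
Qed.

(** An ultrafilter selects one of finitely many values; every constant that must not depend on w is
    obtained this way. *)
Lemma near_bounded m (P : nat -> W -> Prop) :
  (\forall w \near U, exists2 e, (e <= m)%N & P e w) ->
  exists2 e, (e <= m)%N & \forall w \near U, P e w.
Proof.
elim: m => [|m IH] H.
  by exists 0%N => //; apply: filterS H => w [e]; rewrite leqn0 => /eqP->.
have [|/IH[e em Pe]|Pm] := @near_or (fun w => exists2 e, (e <= m)%N & P e w) (P m.+1).
- apply: filterS H => w [e]; rewrite leq_eqVlt => /orP[/eqP->|em Pe]; first by right.
  by left; exists e.
- by exists e => //; exact: leqW.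
- by exists m.+1.
Qed.

Lemma near_choice (T : W -> Type) (d : forall w, T w) (P : forall w, T w -> Prop) :
  (\forall w \near U, exists x, P w x) ->
  exists f : forall w, T w, \forall w \near U, P w (f w).
Proof.
move=> H; exists (fun w => if pselect (exists x, P w x) is left h
  then projT1 (cid h) else d w).
by apply: filterS H => w ex; case: pselect => // h; case: cid.
Qed.

Variable R : W -> comPzRingType.
Implicit Types (f : prod_ring R) (s : seq (prod_ring R)).

Definition upi f : ultraproduct U R := qpi (almost_zero U (R := R)) f.

Lemma upiD f1 f2 : upi (f1 + f2) = upi f1 + upi f2. Proof. exact: qpiD. Qed.
Lemma upiM f1 f2 : upi (f1 * f2) = upi f1 * upi f2. Proof. exact: qpiM. Qed.

Lemma upi_eq f1 f2 : upi f1 = upi f2 <-> \forall w \near U, f1 w = f2 w.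
Proof. exact: ultraproduct_eqP. Qed.

Lemma upi_surj (u : ultraproduct U R) : exists f, u = upi f.
Proof. exact: qpi_surj. Qed.

Lemma upi_seq_surj (u : seq (ultraproduct U R)) : exists s, u = map upi s.
Proof.
elim: u => [|x u [s ->]]; first by exists [::].
by have [f ->] := upi_surj x; exists (f :: s).
Qed.

Definition ev w s : seq (R w) := [seq (f : prod_ring R) w | f <- s].

(** Transposes a family of sequences into a sequence of families, which the common size d makes
    possible; [0] pads the indices outside the good set. *)
Lemma near_seq d (t : forall w, seq (R w)) :
  (\forall w \near U, size (t w) = d) ->
  exists2 s, size s = d & \forall w \near U, ev w s = t w.
Proof.
move=> td; exists (mkseq (fun i w => nth 0 (t w) i) d); first by rewrite size_mkseq.
apply: filterS td => w tw; apply: (@eq_from_nth _ 0).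
  by rewrite size_map size_mkseq tw.
move=> i; rewrite size_map size_mkseq => id.
rewrite (nth_map (0 : prod_ring R)) ?size_mkseq//.
by rewrite (nth_mkseq (0 : prod_ring R) (fun i w => nth 0 (t w) i) id).
Qed.

Lemma los_seq_ideal s f :
  seq_ideal (map upi s) (upi f) <-> \forall w \near U, seq_ideal (ev w s) (f w).
Proof.
elim: s f => [|a s IH] f.
  have E0 : upi f = 0 <-> \forall w \near U, f w = 0.
    by rewrite -[0 in X in X <-> _](qpi0 (almost_zero U (R := R))); exact: (upi_eq f 0).
  rewrite /= seq_ideal_nil /= E0.
  by split; apply: filterS => w; rewrite seq_ideal_nil.
split.
  rewrite /= seq_ideal_cons => -[u [v []]].
  have [b ->] := upi_surj u; have [r ->] := upi_surj v.
  move=> /IH sb _; rewrite -upiM -upiD => /upi_eq E.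
  apply: filterS2 sb E => w sb ->; rewrite seq_ideal_cons.
  by exists (b w), (r w).
move=> H; have [|h hP] := near_choice (fun w => (0, 0) : R w * R w)
  (P := fun w h => seq_ideal (ev w s) h.1 /\ f w = h.1 + h.2 * a w).
  apply: filterS H => w; rewrite /= seq_ideal_cons => -[b [r [sb _ E]]].
  by exists (b, r).
rewrite /= seq_ideal_cons; exists (upi (fun w => (h w).1)), (upi (fun w => (h w).2)).
split=> //; first by apply/IH; apply: filterS hP => w [].
by rewrite -upiM -upiD; apply/upi_eq; apply: filterS hP => w [].
Qed.

Lemma los_chainseq s t :
  chainseq (map upi s) (map upi t) <-> \forall w \near U, chainseq (ev w s) (ev w t).
Proof.
elim: t s => [|a t IH] s /=; first by split=> // _; exact: filterE.
split=> [[/los_seq_ideal/near_not na]|H].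
  by move=> /(IH (a :: s)); apply: filterS2 na.
split; last by apply/(IH (a :: s)); apply: filterS H => w [].
by move=> /los_seq_ideal; apply/near_not; apply: filterS H => w [].
Qed.

Lemma los_has_chain s n :
  has_chain (map upi s) n <-> \forall w \near U, has_chain (ev w s) n.
Proof.
split=> [[u + c]|].
  have [t Et] := upi_seq_surj u; rewrite Et in c * => tn.
  move/los_chainseq: c; apply: filterS => w c; exists (ev w t) => //.
  by rewrite size_map -tn size_map.
move=> H; have [|t tP] := near_choice (fun w => [::] : seq (R w))
  (P := fun w t => size t = n /\ chainseq (ev w s) t).
  by apply: filterS H => w [t tn c]; exists t.
have [|t' t'n Et'] := @near_seq n t; first by apply: filterS tP => w [].
exists (map upi t'); first by rewrite size_map.
by apply/los_chainseq; apply: filterS2 tP Et' => w [_ c] ->.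
Qed.

Lemma los_has_length s l :
  has_length (map upi s) l <-> \forall w \near U, has_length (ev w s) l.
Proof.
rewrite has_lengthP los_has_chain; split.
  move=> [cl ncl]; have : ~ \forall w \near U, has_chain (ev w s) l.+1.
    by move=> /los_has_chain.
  by move=> /near_not; apply: filterS2 cl => w cl' ncl'; apply/has_lengthP.
move=> H; split; first by apply: filterS H => w /has_lengthP[].
by move=> /los_has_chain; apply/near_not; apply: filterS H => w /has_lengthP[].
Qed.

(** * The maximal ideal of the ultraproduct and its powers *)

Section Local.
Variables (M : forall w, set (R w)) (g : seq (prod_ring R)).
Arguments M : clear implicits.
Hypothesis lM : forall w, local_at (M w).
Hypothesis Mg : \forall w \near U, M w = seq_ideal (ev w g).

(** Taking the lifted generators makes finite generation hold by definition; [los_max] recovers the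
    description by almost all coordinates. *)
Definition ultra_max : set (ultraproduct U R) := seq_ideal (map upi g).

Lemma los_max f : ultra_max (upi f) <-> \forall w \near U, M w (f w).
Proof.
rewrite /ultra_max los_seq_ideal.
by split; apply: filterS2 Mg => w <-.
Qed.

Lemma ultra_max_local : local_at ultra_max.
Proof.
split; first exact: ideal_seq.
  move=> /(los_max 1) H; apply: (@filter_not_empty _ U); apply: filterS H => w.
  by case: (lM w).
move=> u; have [f ->] := upi_surj u => nMf.
have [|h hP] := near_choice (fun w => 0 : R w) (P := fun w y => y * f w = 1).
  have : ~ \forall w \near U, M w (f w) by move=> /los_max.
  by move=> /near_not; apply: filterS => w; case: (lM w) => _ _; exact.
by exists (upi h); rewrite -upiM; apply/(upi_eq _ 1).
Qed.

Lemma los_sub_max s : (forall x, x \in map upi s -> ultra_max x) <->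
  \forall w \near U, forall x, x \in ev w s -> M w x.
Proof.
elim: s => [|f s IH] /=; first by split=> // _; exact: filterE.
split=> [H|H u].
  have /los_max Mf : ultra_max (upi f) by apply: H; exact: mem_head.
  have /IH : forall x, x \in map upi s -> ultra_max x.
    by move=> x xs; apply: H; rewrite inE xs orbT.
  by apply: filterS2 Mf => w Mf sM x; rewrite inE => /orP[/eqP->|/sM].
rewrite inE => /orP[/eqP->|us].
  by apply/los_max; apply: filterS H => w; apply; exact: mem_head.
suff /IH : \forall w \near U, forall x, x \in ev w s -> M w x by apply.
by apply: filterS H => w sM x xs; apply: sM; rewrite inE xs orbT.
Qed.

Lemma los_pw k f : pw ultra_max k (upi f) <-> \forall w \near U, pw (M w) k (f w).
Proof.
elim: k f => [|k IH] f /=; first exact: (upi_eq f 1).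
split.
  move=> [u [v []]]; have [a ->] := upi_surj u; have [b ->] := upi_surj v.
  move=> /los_max Ma /IH kb; rewrite -upiM => /upi_eq; apply: filterS3 Ma kb => w Ma kb E.
  by exists (a w), (b w).
move=> H; have [|h hP] := near_choice (fun w => (0, 0) : R w * R w)
  (P := fun w h => [/\ M w h.1, pw (M w) k h.2 & f w = h.1 * h.2]).
  by apply: filterS H => w [x [y xy]]; exists (x, y).
exists (upi (fun w => (h w).1)), (upi (fun w => (h w).2)); split.
- by apply/los_max; apply: filterS hP => w [].
- by apply/IH; apply: filterS hP => w [].
- by rewrite -upiM; apply/upi_eq; apply: filterS hP => w [].
Qed.

Lemma los_pw_sub k s : pw ultra_max k `<=` seq_ideal (map upi s) <->
  \forall w \near U, pw (M w) k `<=` seq_ideal (ev w s).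
Proof.
split=> [H|H u].
  apply: contrapT => /near_not nH.
  have [|f fP] := near_choice (fun w => 0 : R w)
      (P := fun w x => pw (M w) k x /\ ~ seq_ideal (ev w s) x).
    by apply: filterS nH => w /existsNP[x /not_implyP]; exists x.
  have /H/los_seq_ideal : pw ultra_max k (upi f).
    by apply/los_pw; apply: filterS fP => w [].
  by apply/near_not; apply: filterS fP => w [].
have [f ->] := upi_surj u => /los_pw kf; apply/los_seq_ideal.
by apply: filterS2 H kf => w; exact.
Qed.

(** The converse fails in general, because the exponents in the factors may be unbounded. *)
Lemma los_param s : param ultra_max (map upi s) ->
  \forall w \near U, param (M w) (ev w s).
Proof.
move=> [/los_sub_max sM [k /los_pw_sub sk]].
by apply: filterS2 sM sk => w sM sk; split=> //; exists k.
Qed.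

(** A common length repairs the converse: it transfers to R_nat, where [has_length_pw] turns it into
    an exponent. *)
Lemma near_param_length s l :
  (\forall w \near U, param (M w) (ev w s) /\ has_length (ev w s) l) ->
  param ultra_max (map upi s) /\ has_length (map upi s) l.
Proof.
move=> H; have sl : has_length (map upi s) l.
  by apply/los_has_length; apply: filterS H => w [].
split=> //; split; last by exists l; exact: has_length_pw ultra_max_local _ _ sl.
by apply/los_sub_max; apply: filterS H => w [[]].
Qed.

Lemma near_generic_length d l : (\forall w \near U, gdim (R w) = Some d) ->
  (\forall w \near U, exists t,
     [/\ gdim (R w) = Some (size t), param (M w) t & has_length t l]) ->
  exists t : seq (ultraproduct U R), [/\ size t = d, param ultra_max t & has_length t l].
Proof.
move=> gd H; have [|t tP] := near_choice (fun w => [::] : seq (R w))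
  (P := fun w t => [/\ gdim (R w) = Some (size t), param (M w) t & has_length t l]).
  exact: H.
have [|s sd Es] := @near_seq d t.
  by apply: filterS2 gd tP => w gd [+ _ _]; rewrite gd => -[].
exists (map upi s); rewrite size_map.
have [|ps sl] := @near_param_length s l; last by [].
by apply: filterS2 Es tP => w -> [].
Qed.

(** * Dimension, parameter degree and pi-dimension of the ultraproduct *)

Section Dimension.
Variables d d' : nat.
Hypothesis gd : gdim (ultraproduct U R) = Some d.
Hypothesis gd' : \forall w \near U, gdim (R w) = Some d'.

Let lU := ultra_max_local.
Let UE : ultra_max = seq_ideal (map upi g) := erefl.

Lemma gdim_near_le : (d' <= d)%N.
Proof.
have [[u + pu] _] := (gdimP lU UE d).1 gd.
have [s Es] := upi_seq_surj u; rewrite Es in pu * => sd.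
have /filter_ex[w [[gdw Mgw] pw]] : \forall w \near U,
  (gdim (R w) = Some d' /\ M w = seq_ideal (ev w g)) /\ param (M w) (ev w s).
  by apply: filterS3 gd' Mg (los_param pu).
have [_ /(_ _ pw)] := (gdimP (lM w) Mgw d').1 gdw.
by rewrite size_map -sd size_map.
Qed.

Lemma parameter_degree_eqdim p : (\forall w \near U, parameter_degree (R w) = Some p) ->
  d = d'.
Proof.
move=> pp; have [|s [sd ps _]] := @near_generic_length d' p gd'.
  apply: filterS2 Mg pp => w Mgw /(parameter_degreeP (lM w) _)[[s ?] _].
  by exists s.
have [_ /(_ _ ps)] := (gdimP lU UE d).1 gd.
by rewrite sd => ?; apply/eqP; rewrite eqn_leq gdim_near_le andbT.
Qed.

Lemma near_parameter_degree p : d = d' -> parameter_degree (ultraproduct U R) = Some p ->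
  \forall w \near U, parameter_degree (R w) = Some p.
Proof.
move=> dd /(parameter_degreeP lU _)[[u []]]; have [s ->] := upi_seq_surj u.
rewrite gd dd size_map => -[ds] /los_param ps /los_has_length sl min.
have : \forall w \near U, forall t l, gdim (R w) = Some (size t) -> param (M w) t ->
    has_length t l -> (p <= l)%N.
  apply: contrapT => /near_not H.
  (* Otherwise almost all R_w have a generic sequence of length below p. One value l < p then occurs
     almost everywhere, and gluing gives a generic sequence of R_nat of length l, against the
     minimality of p. *)
  have {H} : \forall w \near U, exists2 l, (l <= p)%N & (l < p)%N /\
      exists t, [/\ gdim (R w) = Some (size t), param (M w) t & has_length t l].
    apply: filterS H => w H; apply: contrapT => nH; apply: H => t l gt pt tl.
    by rewrite leqNgt; apply/negP => lp; apply: nH; exists l; [exact: ltnW|split=> //; exists t].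
  move=> /near_bounded[l _ H].
  have lp : (l < p)%N by have /filter_ex[w []] := H.
  have [|t [td pt tl]] := @near_generic_length d' l gd'.
    by apply: filterS H => w [].
  by have := min t l; rewrite td leqNgt lp => /(_ erefl pt tl).
move=> minw; have H := near_and (near_and Mg gd') (near_and (near_and ps sl) minw).
apply: filterS H => w [[Mgw gdw] [[pw slw] {}minw]].
apply/(parameter_degreeP (lM w) _); split=> //.
by exists (ev w s); rewrite gdw size_map ds.
Qed.

Hypothesis nR : forall w, noetherian (R w).

Lemma los_colon s b f : colon (seq_ideal (map upi s)) (upi b) (upi f) <->
  \forall w \near U, colon (seq_ideal (ev w s)) (b w) (f w).
Proof. by rewrite /colon /= -upiM los_seq_ideal. Qed.

(** With fewer than d' elements no power of the maximal ideal of R_w lies in (s), so there is an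
    associated prime ((s) : b) omitting some z of that ideal. The b and z glue to an associated
    prime of R_nat strictly below the maximal ideal. *)
Lemma minimal_associated_le (u : seq (ultraproduct U R)) :
  minimal_associated_prime (seq_ideal u) ultra_max -> (d' <= size u)%N.
Proof.
have [s ->] := upi_seq_surj u; rewrite size_map => -[[_ [a Ea]] min].
rewrite leqNgt; apply/negP => sd'.
have /los_sub_max sM : forall x, x \in map upi s -> ultra_max x.
  move=> x xs; rewrite Ea /colon /=.
  by apply: (idealMr _ (ideal_seq _)); exact: mem_seq_ideal.
have [|bz bzP] := near_choice (fun w => (0, 0) : R w * R w)
  (P := fun w bz => [/\ prime_ideal (colon (seq_ideal (ev w s)) bz.1), M w bz.2 &
     ~ colon (seq_ideal (ev w s)) bz.1 bz.2]).
  apply: filterS3 Mg gd' sM => w Mgw gdw sM.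
  have [|b [z bzP]] := associated_prime_exists (@nR w) (lM w) (ideal_seq (ev w s)).
    move=> k sk; have [_ /(_ (ev w s))] := (gdimP (lM w) Mgw d').1 gdw.
    by rewrite size_map leqNgt sd' => /(_ _)/notF; apply; split=> //; exists k.
  by exists (b, z).
pose b : prod_ring R := fun w => (bz w).1; pose z : prod_ring R := fun w => (bz w).2.
pose Q := colon (seq_ideal (map upi s)) (upi b).
have iQ : ideal Q by apply: ideal_colon; exact: ideal_seq.
have Q1 : ~ Q 1.
  move=> /(los_colon s b 1); apply/near_not.
  by apply: filterS bzP => w [[]].
apply: (min Q); split.
- split=> // x y; have [f ->] := upi_surj x; have [h ->] := upi_surj y.
  rewrite -upiM => /los_colon Qfh; have [] := @near_or
    (fun w => colon (seq_ideal (ev w s)) (b w) (f w))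
    (fun w => colon (seq_ideal (ev w s)) (b w) (h w)).
  + by apply: filterS2 Qfh bzP => w Qfh [pQ _ _]; exact: primeM pQ Qfh.
  + by left; apply/los_colon.
  + by right; apply/los_colon.
- by exists (upi b).
- exact: proper_sub_local_at lU iQ Q1.
- move=> /(_ (upi z)) H; have /los_colon : Q (upi z).
    apply: H; apply/los_max;
    by apply: filterS bzP => w [].
  suff /near_not : \forall w \near U, ~ colon (seq_ideal (ev w s)) (b w) (z w) by [].
  by apply: filterS bzP => w [].
Qed.

(** Shortest parameter sequences of the R_w, together with socle elements, glue to (s) and a with
    ((s) : a) maximal. The glued ideal may contain no power of the maximal ideal, so minimality
    needs its own argument. *)
Lemma minimal_associated_exists : exists2 u : seq (ultraproduct U R), size u = d' &
  minimal_associated_prime (seq_ideal u) ultra_max.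
Proof.
have [|t tP] := near_choice (fun w => [::] : seq (R w))
  (P := fun w t => size t = d' /\ param (M w) t).
  apply: filterS2 Mg gd' => w Mgw gdw.
  by have [[t td pt] _] := (gdimP (lM w) Mgw d').1 gdw; exists t.
have [|s sd Es] := @near_seq d' t; first by apply: filterS tP => w [].
have ps : \forall w \near U, param (M w) (ev w s).
  by apply: filterS2 Es tP => w -> [].
exists (map upi s); first by rewrite size_map.
have [|a aP] := near_choice (fun w => 0 : R w) (P := fun w a => colon (seq_ideal (ev w s)) a = M w).
  by apply: filterS ps => w; exact: max_ideal_colon.
split; first split; first exact: local_at_prime lU.
  exists (upi a); apply/seteqP; split=> x; have [f ->] := upi_surj x.
    by move=> /los_max Mf; apply/los_colon; apply: filterS2 Mf aP => w Mf ->.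
  by move=> /los_colon Mf; apply/los_max; apply: filterS2 Mf aP => w Mf <-.
move=> Q [pQ [x EQ]]; have [b Eb] := upi_surj x; rewrite {x}Eb in EQ.
move=> [QM /existsNP[x /not_implyP[]]].
have [f ->] := upi_surj x => /los_max Mf nQf.
have Qw1 : \forall w \near U, ~ colon (seq_ideal (ev w s)) (b w) 1.
  by apply/near_not => H; apply: (primeN1 pQ); rewrite EQ; apply/(los_colon s b 1).
have Qwf : \forall w \near U, ~ colon (seq_ideal (ev w s)) (b w) (f w).
  by apply/near_not => H; apply: nQf; rewrite EQ; apply/los_colon.
have [|h hP] := near_choice (fun w => 0 : R w) (P := fun w y =>
   ~ colon (seq_ideal (ev w s)) (b w) y /\ colon (seq_ideal (ev w s)) (b w) (y * f w)).
  apply: filterS3 (near_and ps Mf) Qw1 Qwf => w [[_ [k kP]] Mfw] Qw1 _.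
  (* The last power of [f w] outside the colon ideal defines h. Its exponent depends on w, which is
     harmless: h is a single element outside Q with hf in Q, contradicting that Q is prime and omits
     f. *)
  have exk : exists k, `[< colon (seq_ideal (ev w s)) (b w) (f w ^+ k) >].
    exists k; apply/asboolP; rewrite /colon /=.
    by apply: (idealMr _ (ideal_seq _)); apply: kP; exact: pw_exp.
  have [[|j] /asboolP jP jmin] := ex_minnP exk; first by rewrite expr0 in jP.
  exists (f w ^+ j); rewrite -exprSr; split=> // /asboolP/jmin.
  by rewrite ltnn.
have [||] := primeM pQ (x := upi h) (y := upi f).
- by rewrite -upiM EQ; apply/los_colon; apply: filterS hP => w [].
- suff : ~ Q (upi h) by [].
  rewrite EQ => /los_colon; apply/near_not.
  by apply: filterS hP => w [].
- by [].
Qed.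

Lemma pidim_ultraproduct : pidim (ultraproduct U R) = Some d'.
Proof.
apply/min_natP; rewrite (local_at_max lU); split.
  exact: minimal_associated_exists.
by move=> _ [u <-]; exact: minimal_associated_le.
Qed.

End Dimension.

(** The lifted generators bound the geometric dimension by [size g] almost everywhere, so one value
    is selected. *)
Lemma gdim_near : exists d', \forall w \near U, gdim (R w) = Some d'.
Proof.
have [|d' _ H] := @near_bounded (size g) (fun e w => gdim (R w) = Some e); last by exists d'.
apply: filterS Mg => w Mgw; have [d gd] := gdim_ex (lM w) Mgw.
exists d => //; have [_ /(_ _ (param_generators Mgw))] := (gdimP (lM w) Mgw d).1 gd.
by rewrite size_map.
Qed.

End Local.
End Ultra.

(** * Cataproducts *)

Section Cohen.
Variable R : comPzRingType.
Implicit Types (A B I M : set R) (s : seq R).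

Definition finitely_generated I := exists s, I = seq_ideal s.

Lemma maximal_not_fg I : ideal I -> ~ finitely_generated I ->
  exists A, [/\ ideal A, ~ finitely_generated A &
    forall B, ideal B -> A `<` B -> finitely_generated B].
Proof.
move=> iI nI; pose P A := A = set0 \/ ideal A /\ ~ finitely_generated A.
have [F FP totF|A [PA maxA]] := @Zorn_bigcup _ P.
  have [[X [FX iX nX]]|nex] :=
      pselect (exists X, [/\ F X, ideal X & ~ finitely_generated X]); last first.
    left; rewrite bigcup0// => X FX; case: (FP X FX) => // -[iX nX].
    by case: nex; exists X.
  right; have FI Y x : F Y -> Y x -> ideal Y.
    by move=> FY Yx; case: (FP Y FY) => [Y0|[]//]; rewrite Y0 in Yx.
  split.
    split=> [|x y [Y FY Yx] [Z FZ Zy]|a x [Y FY Yx]].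
    - by exists X => //; exact: ideal0.
    - have iY := FI _ _ FY Yx; have iZ := FI _ _ FZ Zy.
      have [YZ|ZY] := totF _ _ FY FZ.
        by exists Z => //; apply: idealD => //; exact: YZ.
      by exists Y => //; apply: idealD => //; exact: ZY.
    - by exists Y => //; apply: idealMl => //; exact: FI FY Yx.
  move=> [s Es].
  have sU x : x \in s -> (\bigcup_(Y in F) Y) x by rewrite Es; exact: mem_seq_ideal.
  have [Y [FY iY nY sY]] : exists Y, [/\ F Y, ideal Y, ~ finitely_generated Y &
      forall x, x \in s -> Y x].
    elim: s sU {Es} => [|x s IH] sU; first by exists X.
    have [y ys|Y [FY iY nY sY]] := IH; first by apply: sU; rewrite inE ys orbT.
    have [Z FZ Zx] := sU x (mem_head _ _); have [YZ|ZY] := totF _ _ FY FZ.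
      have iZ := FI _ _ FZ Zx; case: (FP Z FZ) => [Z0|[_ nZ]]; first by rewrite Z0 in Zx.
      by exists Z; split=> // y; rewrite inE => /orP[/eqP->//|/sY]; exact: YZ.
    by exists Y; split=> // y; rewrite inE => /orP[/eqP->|/sY//]; exact: ZY.
  apply: nY; exists s; apply/seteqP; split; last exact: seq_ideal_sub.
  by rewrite -Es => x Yx; exists Y.
case: PA => [A0|[iA nA]].
  case: (maxA I); last by right.
  rewrite A0; split=> // /(_ 0); apply; exact: ideal0.
exists A; split=> // B iB AB; apply: contrapT => nB; apply: (maxA B AB).
by right.
Qed.

Lemma adj_generators I x (u : seq R) : ideal I -> adj setT I x = seq_ideal u ->
  exists ps, (forall p, p \in ps -> I p) /\ adj setT I x `<=` adj setT (seq_ideal ps) x.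
Proof.
move=> iI Eu; have uI z : z \in u -> adj setT I x z by rewrite Eu; exact: mem_seq_ideal.
suff [ps [psI ups]] : exists ps, (forall p, p \in ps -> I p) /\
    forall z, z \in u -> adj setT (seq_ideal ps) x z.
  exists ps; split=> //; rewrite Eu; apply: seq_ideal_sub => //.
  by apply: ideal_adj => //; exact: ideal_seq.
elim: u uI {Eu} => [|z u IH] uI; first by exists [::].
have [y yu|ps [psI ups]] := IH; first by apply: uI; rewrite inE yu orbT.
have [p [r [Ip _ Ez]]] := uI z (mem_head _ _).
exists (p :: ps); split; first by move=> q; rewrite inE => /orP[/eqP->//|/psI].
move=> y; rewrite inE => /orP[/eqP->|/ups[a [q [pa _ ->]]]].
  by exists p, r; split=> //; apply: mem_seq_ideal; exact: mem_head.
by exists a, q; split=> //; rewrite seq_ideal_cons; exact: sub_adj.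
Qed.

(** If xy is in A with neither factor in A, then A + (x) = (ps) + (x) with ps in A, and (A : x) =
    (v) is finitely generated because it contains y. Then A = (ps) + x(v), a contradiction. *)
Lemma maximal_not_fg_prime A : ideal A -> ~ finitely_generated A ->
  (forall B, ideal B -> A `<` B -> finitely_generated B) -> prime_ideal A.
Proof.
move=> iA nA maxA; split=> //.
  move=> A1; apply: nA; exists [:: 1]; rewrite (ideal1 iA A1).
  by rewrite (ideal1 (ideal_seq _) (mem_seq_ideal (mem_head _ _))).
move=> x y Axy; apply: contrapT => /not_orP[nAx nAy]; apply: nA.
have [|u Eu] := maxA (adj setT A x) (ideal_adj _ (@ideal_setT R) iA).
  by split; [exact: sub_adj|move=> /(_ x) H; apply/nAx/H; exact: mem_adj].
have [ps [psA Aps]] := adj_generators iA Eu.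
have [|v Ev] := maxA (colon A x) (ideal_colon _ iA).
  split=> [a Aa|/(_ y) H]; first exact: idealMr.
  by apply/nAy/H; rewrite /colon /= mulrC.
exists (ps ++ [seq z * x | z <- v]); apply/seteqP; split=> a; last first.
  apply: (seq_ideal_sub iA) => z; rewrite mem_cat => /orP[/psA//|/mapP[c cv ->]].
  have : colon A x c by rewrite Ev; exact: mem_seq_ideal.
  by [].
move=> Aa; have [b [r [psb _ Ea]]] : adj setT (seq_ideal ps) x a.
  by apply: Aps; exact: sub_adj.
apply/seq_ideal_catP; exists b, (r * x); split=> //.
have vr : seq_ideal v r.
  rewrite -Ev /colon /=; have -> : r * x = a - b by rewrite Ea addrC addKr.
  by apply: idealB => //; apply: seq_ideal_sub psb.
set J := seq_ideal _; have iJ : ideal J by exact: ideal_seq.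
have iC : ideal [set c | J (c * x)] by exact: ideal_colon.
apply: (seq_ideal_sub iC _ vr) => c cv /=; apply: mem_seq_ideal.
by apply/mapP; exists c.
Qed.

(* An ideal A maximal among those not finitely generated is prime, so for t in
   the maximal ideal but not in A one gets A = (ps) + tA with ps in A; iterating,
   A lies in the closure of (ps). *)
Lemma noetherian_of_closed M g : local_at M -> M = seq_ideal g ->
  (forall s t x, M t -> (forall k, seq_ideal (t ^+ k :: s) x) -> seq_ideal s x) ->
  noetherian R.
Proof.
move=> lM Mg closed I iI; apply: contrapT => nI.
have [A [iA nA maxA]] := maximal_not_fg iI nI.
have pA := maximal_not_fg_prime iA nA maxA.
have AM : A `<=` M by apply: proper_sub_local_at => //; exact: primeN1.
have [t Mt nAt] : exists2 t, M t & ~ A t.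
  apply: contrapT => nex; apply: nA; exists g; rewrite -Mg.
  apply/seteqP; split=> // t Mt; apply: contrapT => nAt; apply: nex.
  by exists t.
have [|u Eu] := maxA (adj setT A t) (ideal_adj _ (@ideal_setT R) iA).
  by split; [exact: sub_adj|move=> /(_ t) H; apply/nAt/H; exact: mem_adj].
have [ps [psA Aps]] := adj_generators iA Eu.
apply: nA; exists ps; apply/seteqP; split; last exact: seq_ideal_sub.
have step a : A a -> exists b r, [/\ seq_ideal ps b, A r & a = b + r * t].
  move=> Aa; have [b [r [psb _ Ea]]] : adj setT (seq_ideal ps) t a.
    by apply: Aps; exact: sub_adj.
  exists b, r; split=> //; suff /(primeM pA)[] : A (r * t) by [].
  have -> : r * t = a - b by rewrite Ea addrC addKr.
  by apply: idealB => //; apply: seq_ideal_sub psb.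
move=> a Aa; apply: (closed ps t a Mt) => k.
have [b [r [psb _ ->]]] : exists b r, [/\ seq_ideal ps b, A r & a = b + r * t ^+ k].
  elim: k => [|k [b [r [psb Ar ->]]]].
    by exists 0, a; split; [exact: ideal0 (ideal_seq _)| |rewrite mulr1 add0r].
  have [b' [r' [psb' Ar' ->]]] := step r Ar.
  exists (b + b' * t ^+ k), r'; split=> //; last by rewrite exprS; ring.
  by apply: (idealD (ideal_seq _)) => //; apply: (idealMr _ (ideal_seq _)).
by rewrite seq_ideal_cons; exists b, r.
Qed.

End Cohen.

Lemma map_mons (R S : comPzRingType) (f : R -> S) k (s : seq R) :
  f 1 = 1 -> {morph f : x y / x * y} -> mons k (map f s) = map f (mons k s).
Proof.
move=> f1 fM; elim: k => [|k IH] /=; first by rewrite f1.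
rewrite map_flatten -!map_comp; congr flatten; apply: eq_map => x /=.
by rewrite IH -!map_comp; apply: eq_map => y /=; rewrite fM.
Qed.

Lemma mons_sub (R : comPzRingType) (g : seq R) n k : (n <= k)%N ->
  seq_ideal (mons k g) `<=` seq_ideal (mons n g).
Proof.
elim: k => [|k IH]; first by rewrite leqn0 => /eqP->; exact: subset_refl.
rewrite leq_eqVlt => /orP[/eqP->|/IH]; first exact: subset_refl.
apply: subset_trans; apply: seq_ideal_sub; first exact: ideal_seq.
move=> _ /flatten_mapP[p pg /mapP[z zk ->]].
by apply: (idealMl _ (ideal_seq _)); exact: mem_seq_ideal.
Qed.

Lemma qpi_seq_ideal (R : comPzRingType) (A : set R) s x :
  seq_ideal (map (qpi A) s) (qpi A x) <->
  exists2 y, seq_ideal s y & ideal_gen A (x - y).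
Proof.
split.
  elim: s x => [|a s IH] x.
    rewrite /= (@seq_ideal_nil (quot_ring A)) => /qpi_eq0 Ax.
    by exists 0; [exact: (ideal0 (ideal_seq [::]))|rewrite subr0].
  rewrite /= (@seq_ideal_cons (quot_ring A)) => -[u [v []]].
  have [b ->] := qpi_surj u; have [r ->] := qpi_surj v.
  move=> /IH[y sy Aby] _; rewrite -qpiM -qpiD => /qpi_eq Ax.
  exists (y + r * a); first by rewrite seq_ideal_cons; exists y, r.
  have -> : x - (y + r * a) = (x - (b + r * a)) + (b - y) by ring.
  exact: (idealD (ideal_gen_ideal A)).
move=> [y sy /qpi_eq ->].
apply: (seq_ideal_sub (ideal_preim (ideal_seq _)) _ sy) => z zs /=.
by apply: mem_seq_ideal; exact: map_f.
Qed.

(** * The separated quotient of a local ring *)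

Section Separated.
Variables (S : comPzRingType) (M : set S) (g : seq S).
Hypotheses (lM : local_at M) (Mg : M = seq_ideal g).

Definition inf_power : set S := \bigcap_n ideal_exp M n.
Notation V := inf_power.
Notation T := (quot_ring V).

(** Says, inside S, that finitely generated ideals of the quotient are closed in the adic topology.
    For ultraproducts it comes from saturation. *)
Hypothesis closed : forall s x, (forall k, seq_ideal (s ++ mons k g) x) ->
  exists2 y, seq_ideal s y & V (x - y).

Lemma inf_powerP x : V x <-> forall k, seq_ideal (mons k g) x.
Proof.
split=> [Vx k|H k _]; last by rewrite Mg ideal_exp_mons.
by rewrite -ideal_exp_mons -Mg; exact: Vx.
Qed.

Lemma ideal_inf_power : ideal V.
Proof.
split=> [|x y /inf_powerP Vx /inf_powerP Vy|a x /inf_powerP Vx]; apply/inf_powerP => k.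
- exact: ideal0 (ideal_seq _).
- exact: (idealD (ideal_seq _)).
- exact: (idealMl _ (ideal_seq _)).
Qed.

Lemma inf_power_gen : ideal_gen V = V.
Proof. exact/smallest_id/ideal_inf_power. Qed.

Lemma sep_seq_ideal s x : seq_ideal (map (qpi V) s) (qpi V x) <->
  exists2 y, seq_ideal s y & V (x - y).
Proof. by rewrite qpi_seq_ideal inf_power_gen. Qed.

Definition sep_max : set T := seq_ideal (map (qpi V) g).

(** This is why parameter sequences of S and their lengths survive unchanged in the quotient by
    [V]. *)
Lemma inf_power_sub_pw s k : pw M k `<=` seq_ideal s -> V `<=` seq_ideal s.
Proof.
move=> Mk x /inf_powerP/(_ k); apply: seq_ideal_sub; first exact: ideal_seq.
move=> y yk; apply: Mk; apply: mons_pw yk => z.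
by rewrite Mg; exact: mem_seq_ideal.
Qed.

Lemma sep_sub s x : V `<=` seq_ideal s ->
  seq_ideal (map (qpi V) s) (qpi V x) <-> seq_ideal s x.
Proof.
move=> Vs; rewrite sep_seq_ideal; split=> [[y sy /Vs sxy]|sx].
  by rewrite -(subrK y x); exact: (idealD (ideal_seq _)).
by exists x => //; rewrite subrr; exact: ideal0 ideal_inf_power.
Qed.

Lemma sep_maxE x : sep_max (qpi V x) <-> M x.
Proof.
have [_ [k gk]] := param_generators Mg.
by rewrite Mg; apply: sep_sub; exact: inf_power_sub_pw gk.
Qed.

Lemma sep_local : local_at sep_max.
Proof.
have [iM M1 uM] := lM; split; first exact: ideal_seq.
  by move=> /(sep_maxE 1).
move=> u; have [x ->] := qpi_surj u => nMx.
have [|y yx] := uM x; first by move=> /sep_maxE.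
by exists (qpi V y); rewrite -qpiM yx.
Qed.

Lemma qpi_seq_surj (u : seq T) : exists s, u = map (qpi V) s.
Proof.
elim: u => [|x u [s ->]]; first by exists [::].
by have [f ->] := qpi_surj x; exists (f :: s).
Qed.

Lemma qpiX x k : qpi V x ^+ k = qpi V (x ^+ k).
Proof. by elim: k => [|k IH]; rewrite ?expr0 ?qpi1// !exprS IH qpiM. Qed.

Lemma sep_noetherian : noetherian T.
Proof.
apply: (noetherian_of_closed sep_local erefl) => u v w.
have [s ->] := qpi_seq_surj u; have [t ->] := qpi_surj v; have [x ->] := qpi_surj w.
move=> /sep_maxE Mt H; apply/sep_seq_ideal; apply: closed => k.
have := H k; rewrite qpiX -[_ :: _]/(map (qpi V) (t ^+ k :: s)) => /sep_seq_ideal[y].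
rewrite seq_ideal_cons => -[a [r [sa _ ->]]] /inf_powerP/(_ k) Vxy.
apply/seq_ideal_catP; exists a, (x - a); split=> //; last by rewrite addrC subrK.
(* The first summand lies in [V], hence in M^k, and t^k lies in M^k because t is in M; so membership
   modulo powers of t becomes membership modulo powers of M. *)
have -> : x - a = (x - (a + r * t ^+ k)) + r * t ^+ k by ring.
apply: (idealD (ideal_seq _)) => //; apply: (idealMl _ (ideal_seq _)).
by apply: pw_mons; rewrite -Mg; exact: pw_exp.
Qed.

Lemma pw_qpi k x : pw M k x -> pw sep_max k (qpi V x).
Proof.
elim: k x => [|k IH] x /=; first by move=> ->.
move=> [y [z [My Mz ->]]]; exists (qpi V y), (qpi V z); split.
- exact/sep_maxE.
- exact: IH.
- exact: qpiM.
Qed.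

Lemma sep_param s : param sep_max (map (qpi V) s) <-> param M s.
Proof.
split=> -[sM [k sk]]; split.
- by move=> x xs; apply/(sep_maxE x); apply: sM; exact: map_f.
(* Lifting from the quotient gives M^k inside (s) + [V], hence inside (s) + M^(k+1), and Nakayama's
   lemma removes the error term. *)
- exists k; apply: (pw_seq_nakayama lM Mg) => x xk.
  have /sk/sep_seq_ideal[y sy /inf_powerP/(_ k.+1) Vxy] : pw sep_max k (qpi V x).
    by apply: pw_qpi; apply: mons_pw xk => z; rewrite Mg; exact: mem_seq_ideal.
  by apply/seq_ideal_catP; exists y, (x - y); split=> //; rewrite addrC subrK.
- by move=> _ /mapP[x xs ->]; apply/sep_maxE/sM.
- exists k => u /pw_mons; rewrite (map_mons _ _ (qpi1 V) (@qpiM _ V)).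
  apply: seq_ideal_sub; first exact: ideal_seq.
  move=> _ /mapP[x xk ->]; apply/sep_seq_ideal; exists x.
    by apply: sk; apply: mons_pw xk => z; rewrite Mg; exact: mem_seq_ideal.
  by rewrite subrr; exact: ideal0 ideal_inf_power.
Qed.

Lemma sep_chainseq s t : V `<=` seq_ideal s ->
  chainseq (map (qpi V) s) (map (qpi V) t) <-> chainseq s t.
Proof.
elim: t s => //= a t IH s Vs; rewrite sep_sub// -[qpi V a :: _]/(map (qpi V) (a :: s)) IH//.
by apply: subset_trans Vs _; rewrite seq_ideal_cons; exact: sub_adj.
Qed.

Lemma sep_has_length s l : param M s ->
  has_length (map (qpi V) s) l <-> has_length s l.
Proof.
move=> [_ [k /inf_power_sub_pw Vs]].
split=> -[[t tl ct] ub].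
  have [t' Et'] := qpi_seq_surj t; rewrite Et' in tl ct.
  move/(sep_chainseq _ Vs) in ct; split; first by exists t' => //; rewrite -tl size_map.
  by move=> t'' /(sep_chainseq _ Vs)/ub; rewrite size_map.
split; first by exists (map (qpi V) t); [rewrite size_map|exact/sep_chainseq].
move=> t'; have [t'' ->] := qpi_seq_surj t' => /(sep_chainseq _ Vs)/ub.
by rewrite size_map.
Qed.

Lemma sep_gdim : gdim T = gdim S.
Proof.
have [d gd] := gdim_ex lM Mg; rewrite gd; apply/(gdimP sep_local erefl).
have [[s sd ps] min] := (gdimP lM Mg d).1 gd; split.
  by exists (map (qpi V) s); [rewrite size_map|exact/sep_param].
move=> u; have [t ->] := qpi_seq_surj u => /sep_param/min.
by rewrite size_map.
Qed.

Lemma sep_parameter_degree : parameter_degree T = parameter_degree S.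
Proof.
have [p pp] := parameter_degree_ex lM Mg; rewrite pp; apply/(parameter_degreeP sep_local).
have [[s [gs ps sl]] min] := (parameter_degreeP lM p).1 pp; rewrite sep_gdim; split.
  exists (map (qpi V) s); rewrite size_map; split=> //; first exact/sep_param.
  exact/sep_has_length.
move=> u l; have [t ->] := qpi_seq_surj u; rewrite size_map => gt /sep_param pt.
by move=> /(sep_has_length _ pt); exact: min.
Qed.

Lemma sep_krull_dim : krull_dim T = gdim S.
Proof.
rewrite -sep_gdim; apply: krull_dim_gdim; last exact: sep_noetherian.
exact: local_at_local sep_local.
Qed.

End Separated.

(** * Countable incompleteness and closed ideals *)

Section Saturation.
Variables (W : Type) (U : set_system W).
Hypotheses (hU : UltraFilter U) (hUci : countably_incomplete U).

Let pU : ProperFilter U := ultra_proper.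

(* kappa w is the last n for which A_0, E_0, ..., A_n, E_n all hold at w, the
   A_n witnessing countable incompleteness. *)
Lemma diagonal (E : nat -> W -> Prop) : (forall k, \forall w \near U, E k w) ->
  exists kappa : W -> nat, forall n, \forall w \near U, (n <= kappa w)%N /\ E (kappa w) w.
Proof.
move=> UE; have [A [UA nA]] := hUci.
pose B n w := forall i, (i <= n)%N -> A i w /\ E i w.
have UB n : \forall w \near U, B n w.
  elim: n => [|n IH].
    by apply: filterS2 (UA 0%N) (UE 0%N) => w Aw Ew i; rewrite leqn0 => /eqP->.
  apply: filterS3 IH (UA n.+1) (UE n.+1) => w Bn Aw Ew i.
  by rewrite leq_eqVlt => /orP[/eqP->//|]; exact: Bn.
have UnB : \forall w \near U, exists n, ~ B n w.
  have : \forall w \near U, ~ (\bigcap_n A n) w by exact/near_not.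
  apply: filterS => w nAw; apply: contrapT => nex; apply: nAw => n _.
  by have /contrapT/(_ n (leqnn n))[] : ~ ~ B n w by move=> nB; apply: nex; exists n.
have [|kappa kP] := near_choice hU (fun w => 0%N)
    (P := fun w k => B k w /\ forall n, B n w -> (n <= k)%N).
  apply: filterS2 (UB 0%N) UnB => w B0 [m nBm].
  have exB : exists n, `[< B n w >] by exists 0%N; exact/asboolP.
  have ubB n : `[< B n w >] -> (n <= m)%N.
    move=> /asboolP Bn; rewrite leqNgt; apply/negP => mn; apply: nBm => i im.
    by apply: Bn; apply: leq_trans im (ltnW mn).
  have [k /asboolP Bk kmax] := ex_maxnP exB ubB.
  by exists k; split=> // n Bn; apply: kmax; exact/asboolP.
exists kappa => n; apply: filterS2 kP (UB n) => w [Bk kmax] Bn.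
by split; [exact: kmax|have [] := Bk _ (leqnn _)].
Qed.

Variable R : W -> comPzRingType.
Implicit Types (f : prod_ring R) (s g : seq (prod_ring R)).

(** At w, f is split as an element of (s) plus one of the power of exponent [kappa w]. As
    [kappa w >= k] almost everywhere for each k, the glued remainder lies in every power at once. *)
Lemma ultraproduct_closed g (V : set (ultraproduct U R)) s f :
  (forall x, (forall k, seq_ideal (mons k (map (upi U (R := R)) g)) x) -> V x) ->
  (forall k,
     seq_ideal (map (upi U (R := R)) s ++ mons k (map (upi U (R := R)) g)) (upi U f)) ->
  exists2 y, seq_ideal (map (upi U (R := R)) s) y & V (upi U f - y).
Proof.
have mU k : mons k (map (upi U (R := R)) g) = map (upi U (R := R)) (mons k g).
  by apply: map_mons => //; exact: upiM.
have mE k w : mons k (ev w g) = ev w (mons k g) by exact: map_mons.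
move=> gV H.
have [k|kappa kP] := @diagonal (fun k w => seq_ideal (ev w s ++ ev w (mons k g)) (f w)).
  have := H k; rewrite mU -map_cat => /(los_seq_ideal hU).
  by apply: filterS => w; rewrite /ev map_cat.
have [|h hP] := near_choice hU (fun w => 0 : R w) (P := fun w y =>
   seq_ideal (ev w s) y /\ seq_ideal (ev w (mons (kappa w) g)) (f w - y)).
  apply: filterS (kP 0%N) => w [_ /seq_ideal_catP[y [z [sy gz ->]]]].
  by exists y; split=> //; rewrite addrC addKr.
exists (upi U h); first by apply/(los_seq_ideal hU); apply: filterS hP => w [].
have -> : upi U f - upi U h = upi U (f - (h : prod_ring R)).
  by apply/eqP; rewrite subr_eq -upiD subrK.
apply: gV => k; rewrite mU; apply/(los_seq_ideal hU).
apply: filterS2 hP (kP k) => w [_ gfh] [kk _].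
by rewrite -!mE in gfh *; have := @mons_sub _ (ev w g) _ _ kk _ gfh.
Qed.

End Saturation.

Theorem theorem5p22 (W : Type) (U : set_system W) (R : W -> comPzRingType)
  (hW : infinite_set [set: W]) (hU : UltraFilter U)
  (hUnp : nonprincipal U) (hUci : countably_incomplete U)
  (hloc : forall w, local_ring (R w)) (hnoeth : forall w, noetherian (R w))
  (hbdd : bounded_embdim U R) :
  [<-> isodimensional (ultraproduct U R);
       \forall w \near U, krull_dim (R w) = gdim (ultraproduct U R);
       \forall w \near U, krull_dim (R w) = krull_dim (cataproduct U R);
       exists p : nat, \forall w \near U, parameter_degree (R w) = Some p]
  /\ forall p : nat,
       (\forall w \near U, parameter_degree (R w) = Some p) ->
       parameter_degree (ultraproduct U R) = Some p /\
       parameter_degree (cataproduct U R) = Some p.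
Proof.
have pU : ProperFilter U := @ultra_proper _ _ hU.
have lM w : local_at (max_ideal (R w)) := noetherian_local_at (hnoeth w) (hloc w).
have [g Mg] : exists g : seq (prod_ring R),
    \forall w \near U, max_ideal (R w) = seq_ideal (ev w g).
  have [m Hm] := hbdd; have [|e _ He] := near_bounded hU (m := m)
    (P := fun e w => embdim (R w) = Some e).
    by apply: filterS Hm => w [e ? ?]; exists e.
  have [|t tP] := near_choice hU (fun w => [::] : seq (R w))
    (P := fun w t => size t = e /\ max_ideal (R w) = seq_ideal t).
    by apply: filterS He => w /min_natP[[t te Mt] _]; exists t.
  have [|g _ gP] := near_seq hU (d := e) (t := t); first by apply: filterS tP => w [].
  by exists g; apply: filterS2 tP gP => w [_ ->] ->.
have lU := ultra_max_local hU lM Mg; have EU := local_at_max lU.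
have [d gd] := gdim_ex lU erefl; have [d' gd'] := gdim_near hU lM Mg.
have closed (s : seq (ultraproduct U R)) x :
    (forall k, seq_ideal (s ++ mons k (map (upi U (R := R)) g)) x) ->
    exists2 y, seq_ideal s y & inf_power (ultra_max (U := U) g) (x - y).
  have [t ->] := upi_seq_surj s; have [f ->] := upi_surj x.
  by apply: (ultraproduct_closed hU hUci) => y; exact: (inf_powerP erefl y).2.
have cata : cataproduct U R = quot_ring (inf_power (ultra_max (U := U) g)) :> comPzRingType.
  by rewrite /cataproduct EU.
have kc : krull_dim (cataproduct U R) = Some d.
  by rewrite cata (sep_krull_dim lU erefl closed).
have pc : parameter_degree (cataproduct U R) = parameter_degree (ultraproduct U R).
  by rewrite cata (sep_parameter_degree lU erefl).
have pd : pidim (ultraproduct U R) = Some d' by exact: (pidim_ultraproduct hU lM Mg gd' hnoeth).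
have kd' : \forall w \near U, krull_dim (R w) = Some d'.
  by apply: filterS gd' => w <-; exact: krull_dim_gdim.
have kdd : (\forall w \near U, krull_dim (R w) = Some d) -> d = d'.
  by move=> kd; have /filter_ex[w []] := near_and hU kd kd'; move=> -> [].
have [p pp] := parameter_degree_ex lU erefl.
have pdd p' : (\forall w \near U, parameter_degree (R w) = Some p') -> d = d'.
  exact: (parameter_degree_eqdim hU lM Mg gd gd').
have dpp : d = d' -> \forall w \near U, parameter_degree (R w) = Some p.
  by move=> dd; exact: (near_parameter_degree hU lM Mg gd gd').
(* After this, (1) reads d = d', while (2) and (3) become the same statement, that almost all Krull
   dimensions are d. *)
rewrite /isodimensional pd kc gd pc pp; split.
  tfae.
  - by move=> [->].
  - by [].
  - by move=> /kdd/dpp; exists p.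
  - by move=> [p' /pdd->].
move=> p' pp'; suff -> : p' = p by [].
by have /filter_ex[w []] := near_and hU pp' (dpp (pdd _ pp')); move=> -> [].
Qed.
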